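(* Let $\boldsymbol\beta_3=(\beta_0,\beta_1,\beta_2,\beta_3)$ with $\beta_k\ge0$ and let $\mathbf{W}=(W,\mathbb{W})\in\mathbf{C}^{\alpha,\boldsymbol\beta_3}([0,T]\times V;V)$ be a nonlinear rough path. For any $\xi\in V$ there exists a positive number $h\le T$ such that the rough differential equation $$Y_t=\xi+\int_0^tW(dr,Y_r)$$ has a solution $Y$ on $[0,h]$ with initial condition $Y_0=\xi$. In addition, with $\gamma_1=\max(\beta_0,\beta_1)+\max(\beta_1,\beta_2)$, $$\|Y\|_{\alpha,[0,h]}\le\min\Big\{(1+(6\gamma_1)^{-1})^{1+\beta_0}(1+\|\mathbf{W}\|_{\mathbf{C}_3})(1+\|\xi\|_V)^{\beta_0},\ 2k_\alpha\Big(\frac{1+\gamma_1}{\gamma_1}\Big)^{1+\gamma_1}\|\mathbf{W}\|_{\mathbf{C}_3}(1+2\|\xi\|_V)^{\gamma_1}\Big\},$$ where $k_\alpha=(1-2^{1-3\alpha})^{-1}$ (if $\gamma_1=0$ the right-hand side is read as $+\infty$, i.e. no bound is asserted).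
   Context: Fix $T>0$, $\alpha\in(\frac13,\frac12]$ and a separable Banach space $V$. For a function $\Phi$ of time, $\Phi_{s,t}:=\Phi_t-\Phi_s$ (for $W(t,x)$: $W_{s,t}(x)=W(t,x)-W(s,x)$). $\mathcal{C}^\alpha([0,T];V)$ is the space of $Y:[0,T]\to V$ with $\|Y\|_\alpha=\sup_{s\ne t}\|Y_{s,t}\|_V/|t-s|^\alpha<\infty$; $\|Y\|_{\alpha,[a,b]}$ is the same supremum over $s\neq t\in[a,b]$; $\mathcal{C}_2^{2\alpha}([0,T]^2;V)$ is the space of $R:[0,T]^2\to V$ with $\sup_{s\ne t}\|R_{s,t}\|_V/|t-s|^{2\alpha}<\infty$. For $\boldsymbol\beta_n=(\beta_0,\dots,\beta_n)$ with $\beta_k\ge0$, $\mathcal{C}^{\alpha,\boldsymbol\beta_n}([0,T]\times V;V)$ is the space of functions $\Phi$, $n$ times continuously Fréchet differentiable in space, with $$\|\Phi\|_{\alpha,\boldsymbol\beta_n}=\sum_{k=0}^n\sup_{s\ne t,\,x\in V}\frac{\|D^k\Phi_{s,t}(x)\|}{|t-s|^\alpha(1+\|x\|_V)^{\beta_k}}<\infty .$$ For multi-indices $\boldsymbol\beta^1,\boldsymbol\beta^2$ of length $m+1$ and $\gamma>0$, $\mathcal{C}_2^{\gamma,\boldsymbol\beta^1,\boldsymbol\beta^2}([0,T]^2\times V^2;V)$ is the space of $\Psi$, $m$ times continuously Fréchet differentiable in $(x_1,x_2)\in V^2$ (normed by $\|x_1\|_V+\|x_2\|_V$), with $$\|\Psi\|_{\gamma,\boldsymbol\beta^1,\boldsymbol\beta^2}=\sum_{k=0}^m\sup_{s\ne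 t,\,(x_1,x_2)\in V^2}\frac{\|D^k\Psi_{s,t}(x_1,x_2)\|}{|t-s|^\gamma(1+\|x_1\|_V)^{\beta^1_k}(1+\|x_2\|_V)^{\beta^2_k}}<\infty .$$ Given $\boldsymbol\beta_n$, $n\ge1$, set $\beta^*_k=\max\{\beta_0,\dots,\beta_k\}$, $\beta^{**}_k=\max\{\beta_1,\dots,\beta_{k+1}\}$ for $0\le k\le n-1$, $\boldsymbol\beta^*_{n-1}=(\beta^*_0,\dots,\beta^*_{n-1})$, $\boldsymbol\beta^{**}_{n-1}=(\beta^{**}_0,\dots,\beta^{**}_{n-1})$. A nonlinear rough path $\mathbf{W}=(W,\mathbb{W})\in\mathbf{C}^{\alpha,\boldsymbol\beta_n}([0,T]\times V;V)$ is a pair with $W\in\mathcal{C}^{\alpha,\boldsymbol\beta_n}([0,T]\times V;V)$, $\mathbb{W}\in\mathcal{C}_2^{2\alpha,\boldsymbol\beta^*_{n-1},\boldsymbol\beta^{**}_{n-1}}([0,T]^2\times V^2;V)$, satisfying Chen's relation $\mathbb{W}_{s,t}(x,y)-\mathbb{W}_{s,u}(x,y)-\mathbb{W}_{u,t}(x,y)=DW_{u,t}(y)(W_{s,u}(x))$ for all $x,y\in V$, $s,u,t\in[0,T]$. Set $\|\mathbf{W}\|_{\mathbf{C}_n}=\|W\|_{\alpha,\boldsymbol\beta_n}+\|\mathbb{W}\|_{2\alpha,\boldsymbol\beta^*_{n-1},\boldsymbol\beta^{**}_{n-1}}$. $\mathcal{E}_W^{2\alpha}$ is the set of pairs $(Y,\dot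 Y)\in\mathcal{C}^\alpha([0,T];V)^2$ such that $R^Y_{s,t}:=Y_{s,t}-W_{s,t}(\dot Y_s)$ belongs to $\mathcal{C}_2^{2\alpha}([0,T]^2;V)$. For such a pair the nonlinear rough integral is $$\int_s^tW(dr,Y_r):=\lim_{|\pi|\to0}\sum_{k=1}^n\big[W_{t_{k-1},t_k}(Y_{t_{k-1}})+\mathbb{W}_{t_{k-1},t_k}(\dot Y_{t_{k-1}},Y_{t_{k-1}})\big]$$ over partitions $\pi=(s=t_0<\dots<t_n=t)$ of mesh $|\pi|\to0$ (the limit exists). A solution of $Y_t=\xi+\int_0^tW(dr,Y_r)$ on an interval $[0,h]$ is an $\alpha$-Hölder continuous $Y:[0,h]\to V$ with $Y_0=\xi$, such that $(Y,Y)\in\mathcal{E}^{2\alpha}_W$ (with $[0,T]$ replaced by $[0,h]$, $\dot Y=Y$) and the equation holds for all $t\in[0,h]$, the integral being the nonlinear rough integral with $\dot Y=Y$. *)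

(* Defs.v *)
From HB Require Import structures.
From mathcomp Require Import all_boot all_order all_algebra.
From mathcomp Require Import all_classical all_reals all_analysis.

Set Implicit Arguments.
Unset Strict Implicit.
Unset Printing Implicit Defensive.
Import Order.TTheory GRing.Theory Num.Theory.
Import numFieldNormedType.Exports.
Local Open Scope classical_set_scope.
Local Open Scope ring_scope.

Section ContinuousLinearMaps.
Context {R : realType} (U V : normedModType R).

Definition is_clin : {pred U -> V} :=
  mem [set f : U -> V | linear f /\ continuous f].

Record clin := Clin { clin_fun :> U -> V ; clinP : clin_fun \in is_clin }.

HB.instance Definition _ := [isSub for clin_fun].
HB.instance Definition _ := [Choice of clin by <:].

Lemma is_clin_submod : submod_closed is_clin.
Proof.
split=> [|a f g].
  rewrite inE /=; split=> [c x y|]; last exact: cst_continuous.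
  by rewrite /= scaler0 addr0.
rewrite !inE /= => -[lf cf] [lg cg]; split=> [c x y|x].
  rewrite /= !fctE /= lf lg; rewrite !scalerDr !scalerA (mulrC a c).
  by rewrite -!addrA; congr (_ + _); rewrite addrCA.
apply: cvgD; last exact: cg.
by apply: cvgZl_tmp; exact: cf.
Qed.

HB.instance Definition _ := GRing.isSubmodClosed.Build R (U -> V) is_clin
  is_clin_submod.
HB.instance Definition _ := [SubChoice_isSubLmodule of clin by <:].

Lemma clin_linear (f : clin) : linear f.
Proof. by have := clinP f; rewrite inE => -[]. Qed.

Lemma clin_continuous (f : clin) : continuous f.
Proof. by have := clinP f; rewrite inE => -[]. Qed.

HB.instance Definition _ (f : clin) :=
  GRing.isLinear.Build R U V *:%R f (clin_linear f).

Definition opnorm (f : clin) : R :=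
  sup [set `|f x| | x in [set x : U | `|x| <= 1]].

Lemma opnorm_has_sup (f : clin) :
  has_sup [set `|f x| | x in [set x : U | `|x| <= 1]].
Proof.
split; first by exists `|f 0|, 0 => //=; rewrite normr0.
have /bounded_funP/(_ 1) [M fM] : bounded_near f (nbhs (0 : U)).
  by apply: continuous_linear_bounded; exact: clin_continuous.
by exists M => _ [x /= x1 <-]; exact: fM.
Qed.

Lemma opnorm_ub (f : clin) (x : U) : `|x| <= 1 -> `|f x| <= opnorm f.
Proof.
move=> x1; apply: sup_upper_bound; first exact: opnorm_has_sup.
by exists x.
Qed.

Lemma opnorm_le (f : clin) (M : R) :
  (forall x : U, `|x| <= 1 -> `|f x| <= M) -> opnorm f <= M.
Proof.
move=> fM; apply: ge_sup; first by case: (opnorm_has_sup f).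
by move=> _ [x /= x1 <-]; exact: fM.
Qed.

Lemma opnorm_ge0 (f : clin) : 0 <= opnorm f.
Proof. by apply: le_trans (@opnorm_ub f 0 _); rewrite ?normr0. Qed.

Lemma opnorm_bound (f : clin) (x : U) : `|f x| <= opnorm f * `|x|.
Proof.
have [->|x0] := eqVneq x 0; first by rewrite linear0 !normr0 mulr0.
have xp : 0 < `|x| by rewrite normr_gt0.
rewrite -ler_pdivrMr// mulrC -[X in X * _ <= _]gtr0_norm ?invr_gt0//.
rewrite -normrZ -linearZ; apply: opnorm_ub.
by rewrite normrZ gtr0_norm ?invr_gt0// mulVf// gt_eqF.
Qed.

Lemma opnormD (f g : clin) : opnorm (f + g) <= opnorm f + opnorm g.
Proof.
apply: opnorm_le => x x1; rewrite (le_trans (ler_normD _ _))//.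
by apply: lerD; exact: opnorm_ub.
Qed.

Lemma opnormZ (a : R) (f : clin) : opnorm (a *: f) = `|a| * opnorm f.
Proof.
have le b g : opnorm (b *: g) <= `|b| * opnorm g.
  apply: opnorm_le => x x1; rewrite [leLHS]normrZ.
  by apply: ler_wpM2l => //; exact: opnorm_ub.
apply/eqP; rewrite eq_le le/=.
have [->|a0] := eqVneq a 0; first by rewrite normr0 mul0r opnorm_ge0.
rewrite -ler_pdivlMl ?normr_gt0// -normfV (le_trans _ (le _ _))//.
by rewrite scalerA mulVf// scale1r.
Qed.

Lemma opnorm0_eq0 (f : clin) : opnorm f = 0 -> f = 0.
Proof.
move=> f0; apply/val_inj/funext => x /=; apply/eqP; rewrite -normr_le0.
by rewrite (le_trans (opnorm_bound f x))// f0 mul0r.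
Qed.

HB.instance Definition _ :=
  Lmodule_isNormed.Build R clin opnormD opnormZ opnorm0_eq0.

End ContinuousLinearMaps.

(** The library norms [U * V] by the maximum of the norms. *)

Definition sumprod (U V : Type) : Type := (U * V)%type.

Section SumProduct.
Context {R : realType} (U V : normedModType R).
Local Notation UV := (sumprod U V).

HB.instance Definition _ := GRing.Lmodule.copy UV (U * V)%type.

Definition sumnorm (p : UV) : R := `|p.1| + `|p.2|.

Lemma sumnormD (p q : UV) : sumnorm (p + q) <= sumnorm p + sumnorm q.
Proof. by rewrite /sumnorm addrACA lerD// ler_normD. Qed.

Lemma sumnormZ (a : R) (p : UV) : sumnorm (a *: p) = `|a| * sumnorm p.
Proof. by rewrite /sumnorm mulrDr -!normrZ. Qed.

Lemma sumnorm0_eq0 (p : UV) : sumnorm p = 0 -> p = 0.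
Proof.
case: p => x y /eqP; rewrite /sumnorm paddr_eq0//= !normr_eq0.
by move=> /andP[/eqP-> /eqP->].
Qed.

HB.instance Definition _ :=
  Lmodule_isNormed.Build R UV sumnormD sumnormZ sumnorm0_eq0.

End SumProduct.

Section IteratedDerivatives.
Context {R : realType} (U V : normedModType R).

(** [multi k] is [L(U, L(U, ... L(U, V)))], with [k] copies of [U]. *)
Fixpoint multi (k : nat) : normedModType R :=
  if k is k'.+1 then clin U (multi k') else V.

(** The default value [0] is used only when ['d f x] is not continuous, hence
    only at points where [f] is not differentiable. *)
Definition frechet (W : normedModType R) (f : U -> W) (x : U) : clin U W :=
  insubd (0 : clin U W) ('d f x : U -> W).

Fixpoint iter_frechet (k : nat) (f : U -> V) : U -> multi k :=
  match k with
  | 0 => f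
  | k'.+1 => frechet (iter_frechet k' f)
  end.

Definition Cn_frechet (n : nat) (f : U -> V) : Prop :=
  (forall k, (k < n)%N -> forall x, differentiable (iter_frechet k f) x) /\
  continuous (iter_frechet n f).

End IteratedDerivatives.

Section Holder.
Context {R : realType}.

Section OneAndTwoParameters.
Context {V : normedModType R}.

Definition incr (Y : R -> V) (s t : R) : V := Y t - Y s.

Definition holder2_norm (g a b : R) (P : R -> R -> V) : \bar R :=
  ereal_sup [set r | exists s t, [/\ s \in `[a, b], t \in `[a, b], s != t
    & r = (`|P s t| / `|t - s| `^ g)%:E]].

Definition holder_norm (g a b : R) (Y : R -> V) : \bar R :=
  holder2_norm g a b (incr Y).

End OneAndTwoParameters.

Section Weighted.
Context {V : normedModType R}.

(** Multi-indices are sequences [b : nat -> R] of which only the first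
    [n.+1] (resp. [m.+1]) entries are used. *)

Definition field_incr (F : R -> V -> V) (s t : R) : V -> V :=
  fun x => F t x - F s x.

Definition field_norm (T a : R) (n : nat) (b : nat -> R) (F : R -> V -> V)
    : \bar R :=
  (\sum_(0 <= k < n.+1)
    ereal_sup [set r | exists s t x, [/\ s \in `[0%R, T], t \in `[0%R, T], s != t
      & r = (`|iter_frechet k (field_incr F s t) x|
             / (`|t - s| `^ a * (1 + `|x|) `^ b k))%:E]])%E.

Definition field_space (T a : R) (n : nat) (b : nat -> R) (F : R -> V -> V)
    : Prop :=
  (forall t, t \in `[0, T] -> Cn_frechet n (F t)) /\
  (field_norm T a n b F < +oo)%E.

Definition field2_norm (T g : R) (m : nat) (b1 b2 : nat -> R)
    (P : R -> R -> sumprod V V -> V) : \bar R :=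
  (\sum_(0 <= k < m.+1)
    ereal_sup [set r | exists s t (x : sumprod V V),
      [/\ s \in `[0%R, T], t \in `[0%R, T], s != t
      & r = (`|iter_frechet k (P s t) x|
             / (`|t - s| `^ g * (1 + `|x.1|) `^ b1 k
                * (1 + `|x.2|) `^ b2 k))%:E]])%E.

Definition field2_space (T g : R) (m : nat) (b1 b2 : nat -> R)
    (P : R -> R -> sumprod V V -> V) : Prop :=
  (forall s t, s \in `[0, T] -> t \in `[0, T] -> Cn_frechet m (P s t)) /\
  (field2_norm T g m b1 b2 P < +oo)%E.

End Weighted.

(** [bstar b k = max(b_0, .., b_k)] and [bstarstar b k = max(b_1, .., b_k.+1)] *)
Definition bstar (b : nat -> R) (k : nat) : R :=
  \big[Num.max/b 0%N]_(0 <= j < k.+1) b j.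
Definition bstarstar (b : nat -> R) (k : nat) : R :=
  \big[Num.max/b 1%N]_(1 <= j < k.+2) b j.

Section RoughPaths.
Context {V : normedModType R}.
Implicit Types (W : R -> V -> V) (WW : R -> R -> sumprod V V -> V).

Definition chen (T : R) W WW : Prop :=
  forall (x y : V) (s u t : R),
    s \in `[0, T] -> u \in `[0, T] -> t \in `[0, T] ->
    WW s t (x, y) - WW s u (x, y) - WW u t (x, y)
    = 'd (field_incr W u t) y (field_incr W s u x).

(** Meaningful for [n >= 1] only. *)
Definition nonlinear_rough_path (T a : R) (n : nat) (b : nat -> R) W WW
    : Prop :=
  [/\ field_space T a n b W,
      field2_space T (2 * a) n.-1 (bstar b) (bstarstar b) WW
    & chen T W WW].

Definition rough_norm (T a : R) (n : nat) (b : nat -> R) W WW : \bar R :=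
  (field_norm T a n b W
   + field2_norm T (2 * a)%R n.-1 (bstar b) (bstarstar b) WW)%E.

Definition controlled (h a : R) W (Y Y' : R -> V) : Prop :=
  [/\ (holder_norm a 0%R h Y < +oo)%E,
      (holder_norm a 0%R h Y' < +oo)%E
    & (holder2_norm (2 * a)%R 0%R h
         (fun s t => incr Y s t - field_incr W s t (Y' s))%R < +oo)%E].

(** As in [itv_partition s t p], the partition points are [s :: p]. *)
Definition partition_mesh (s t : R) : set_system (seq R) :=
  [set A : set (seq R) | exists2 d : R, 0 < d & forall p : seq R,
    itv_partition s t p ->
    (forall k, (k < size p)%N ->
       nth t (s :: p) k.+1 - nth t (s :: p) k < d) -> A p].

Definition rough_sum W WW (Y Y' : R -> V) (s t : R) (p : seq R) : V :=
  let c := nth t (s :: p) in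
  \sum_(0 <= k < size p)
    (field_incr W (c k) (c k.+1) (Y (c k))
     + WW (c k) (c k.+1) (Y' (c k), Y (c k))).

Definition rough_integral W WW (Y Y' : R -> V) (s t : R) : V :=
  lim (rough_sum W WW Y Y' s t @ partition_mesh s t).

Definition rde_solution (a h : R) W WW (xi : V) (Y : R -> V) : Prop :=
  [/\ (holder_norm a 0%R h Y < +oo)%E,
      Y 0 = xi,
      controlled h a W Y Y
    & forall t, t \in `[0, h] ->
        cvg (rough_sum W WW Y Y 0 t @ partition_mesh 0 t) /\
        Y t = xi + rough_integral W WW Y Y 0 t].

End RoughPaths.

End Holder.

Definition separable_space (T : topologicalType) : Prop :=
  exists2 D : set T, countable D & dense D.

(* Main.v *)
Require Import Defs.
From mathcomp Require Import all_boot all_order all_algebra.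
From mathcomp Require Import all_classical all_reals all_analysis.
From mathcomp Require Import ring lra.

Set Implicit Arguments.
Unset Strict Implicit.
Unset Printing Implicit Defensive.
Import Order.TTheory GRing.Theory Num.Theory.
Import numFieldNormedType.Exports.
Local Open Scope classical_set_scope.
Local Open Scope ring_scope.

(** The solution is the limit of the second order Euler schemes
      phi_{s,t}(x) = x + W_{s,t}(x) + WW_{s,t}(x, x)
    along partitions whose mesh tends to 0, on a time interval so short that
    the schemes started at xi stay in the unit ball around xi.  There is no
    compactness in V: convergence comes from Lipschitz estimates, and these
    use three derivatives of W and two of WW.

    Chen's relation makes phi an almost flow: the defect
    phi_{u,t} o phi_{s,u} - phi_{s,t} is the sum of the first order Taylor
    remainder of W_{u,t}, of DW_{u,t} applied to WW_{s,u} and of an increment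
    of WW_{u,t} ([rough_step_defect]).  Each term is of size |t - s|^(3 alpha),
    together with its Lipschitz constant on a ball ([rough_step_almost_flow]).

    Since 3 alpha > 1, such a defect can be summed.  Splitting a partition at
    its middle shows by induction that the Euler scheme over any partition of
    [s, t] is within D |t - s|^(3 alpha) of the single step phi_{s,t}
    ([euler_davie]); the same induction applied to the difference of two
    schemes shows that the schemes are Lipschitz, uniformly in the partition
    ([euler_diff], [euler_lip]).  Refining a partition therefore moves the
    result by at most a constant times the sum of the (t_{k+1} - t_k)^(3 alpha)
    ([euler_refine]), which vanishes with the mesh.  The schemes form a Cauchy
    family, and the limit Y satisfies Davie's estimate
      |Y_t - phi_{s,t}(Y_s)| <= D |t - s|^(3 alpha)
    ([euler_limit_davie], [local_davie_solution]).

    Davie's estimate says that Y solves the equation: summed over a partition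
    of [0, t] it compares Y_t - xi with the compensated Riemann sum
    ([rough_sum_cvg]), and on one interval it gives the Hoelder and remainder
    bounds ([davie_controlled]).

    It also gives |Y_t - Y_s| <= |t - s|^alpha (N (1 + |Y_s|)^(beta_0) + eta),
    where N is the norm of the rough path and both eta and |Y_s - xi| tend to 0
    with h.  When gamma_1 > 0, the two announced constants exceed
    N (1 + |xi|)^(beta_0) by a definite margin as soon as N > 0, so they are
    upper bounds for h small enough; when N = 0 the solution is constant. *)

(** * Identities between linear combinations of vectors *)

(** Two formal linear combinations of the same vectors have the same value as
    soon as their coefficients agree, and the latter is an identity in the ring
    of scalars, where [ring] decides it.  The tactic [lin_module] below reifies
    both sides of a vector equation in this syntax. *)
Inductive lincomb (R : Type) : Type :=
| LAtom of nat
| LZero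
| LAdd of lincomb R & lincomb R
| LOpp of lincomb R
| LScale of R & lincomb R.

Section LinearCombinations.
Context {R : pzRingType} {V : lmodType R}.

Fixpoint lc_eval (vs : seq V) (e : lincomb R) : V :=
  match e with
  | LAtom i => nth 0 vs i
  | LZero => 0
  | LAdd a b => lc_eval vs a + lc_eval vs b
  | LOpp a => - lc_eval vs a
  | LScale k a => k *: lc_eval vs a
  end.

Fixpoint lc_coef (e : lincomb R) (i : nat) : R :=
  match e with
  | LAtom j => if eqn j i then 1 else 0
  | LZero => 0
  | LAdd a b => lc_coef a i + lc_coef b i
  | LOpp a => - lc_coef a i
  | LScale k a => k * lc_coef a i
  end.

Lemma lc_evalE (vs : seq V) (e : lincomb R) :
  lc_eval vs e = \sum_(0 <= i < size vs) lc_coef e i *: nth 0 vs i.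
Proof.
elim: e => [i||a IHa b IHb|a IHa|k a IHa] /=.
- have [ilt|ige] := ltnP i (size vs).
    rewrite big_mkord (bigD1 (Ordinal ilt))//= (introT eqnP (erefl i)) scale1r big1 ?addr0//.
    move=> j; rewrite -val_eqE /= => ji.
    by case: eqnP => [ij|_]; [rewrite ij eqxx in ji|rewrite scale0r].
  rewrite nth_default// big1_seq// => j /= jin.
  case: eqnP => [ij|_]; last by rewrite scale0r.
  by move: jin; rewrite mem_index_iota -ij ltnNge ige.
- by rewrite big1// => i _; rewrite scale0r.
- by rewrite IHa IHb -big_split /=; apply: eq_bigr => i _; rewrite scalerDl.
- by rewrite IHa -sumrN; apply: eq_bigr => i _; rewrite scaleNr.
- by rewrite IHa scaler_sumr; apply: eq_bigr => i _; rewrite scalerA.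
Qed.

Fixpoint lc_agree (e f : lincomb R) (i n : nat) : Prop :=
  if n is n'.+1 then lc_coef e i = lc_coef f i /\ lc_agree e f i.+1 n'
  else True.

(** The agreement is a conjunction computed by recursion on the number of
    vectors, so that it reduces to one scalar equation per vector. *)
Lemma lc_agreeP (vs : seq V) (e f : lincomb R) :
  lc_agree e f 0 (size vs) -> lc_eval vs e = lc_eval vs f.
Proof.
move=> h; rewrite !lc_evalE; apply: eq_big_nat => i /andP[_].
have: forall n j, lc_agree e f j n ->
    forall k, (j <= k < j + n)%N -> lc_coef e k = lc_coef f k.
  elim=> [j _ k|n IH j /= [ej er] k]; first by rewrite addn0 ltnNge => /andP[->].
  rewrite leq_eqVlt => /andP[/orP[/eqP<-//|jk] kn].
  by apply: (IH j.+1) => //; rewrite jk addSnnS.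
by move=> /(_ _ _ h) /(_ i) + ilt; rewrite add0n => -> //; rewrite ilt.
Qed.

End LinearCombinations.

Ltac lc_mem v vs :=
  lazymatch vs with
  | nil => constr:(false)
  | v :: _ => constr:(true)
  | _ :: ?r => lc_mem v r
  end.
Ltac lc_atoms t vs :=
  lazymatch t with
  | GRing.zero => vs
  | GRing.add ?a ?b => let vs := lc_atoms a vs in lc_atoms b vs
  | GRing.opp ?a => lc_atoms a vs
  | GRing.scale _ ?a => lc_atoms a vs
  | _ => let b := lc_mem t vs in
         lazymatch b with true => vs | false => constr:(t :: vs) end
  end.
Ltac lc_index v vs :=
  lazymatch vs with
  | v :: _ => constr:(0%N)
  | _ :: ?r => let n := lc_index v r in constr:(S n)
  end.
Ltac lc_reify R t vs :=
  lazymatch t with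
  | GRing.zero => constr:(@LZero R)
  | GRing.add ?a ?b =>
      let a := lc_reify R a vs in let b := lc_reify R b vs in
      constr:(@LAdd R a b)
  | GRing.opp ?a => let a := lc_reify R a vs in constr:(@LOpp R a)
  | GRing.scale ?k ?a => let a := lc_reify R a vs in constr:(@LScale R k a)
  | _ => let n := lc_index t vs in constr:(@LAtom R n)
  end.

(** Vectors are identified up to syntactic equality only. *)
Ltac lin_module R :=
  lazymatch goal with
  | |- @eq ?T ?a ?b =>
      let vs := lc_atoms a (@nil T) in let vs := lc_atoms b vs in
      let ea := lc_reify R a vs in let eb := lc_reify R b vs in
      apply: (@lc_agreeP _ _ vs ea eb); cbn [lc_agree lc_coef size eqn];
      repeat split; ring
  end.

(** * Mean value inequalities for Frechet derivatives *)

Section MeanValue.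
Context {R : realType}.

(** The supremum c of the times t at which |g t - g 0| <= M t has this
    property too, and the local bound at c would push it beyond c if c < 1. *)
Lemma local_slope_increment (W : normedModType R) (g : R -> W) (M : R) :
  (forall c : R, 0 <= c <= 1 ->
    \forall t \near c, `|g t - g c| <= M * `|t - c|) ->
  `|g 1 - g 0| <= M.
Proof.
move=> gM.
pose S := [set t | 0 <= t <= 1 /\ `|g t - g 0| <= M * t].
have S0 : S 0 by split; rewrite ?lexx ?ler01// subrr normr0 mulr0.
have Sub : ubound S 1 by move=> t [/andP[]].
have hS : has_sup S by split; [exists 0|exists 1].
pose c := sup S.
have c01 : 0 <= c <= 1.
  by rewrite /c ge_sup ?andbT; [apply: ub_le_sup => //; exists 1|exists 0|].
have /nbhs_ballP[d /= d0 gd] := gM _ c01.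
have Sc : S c.
  split=> //.
  have [t St tc] := sup_adherent d0 hS.
  have tlec : t <= c by apply: sup_upper_bound.
  have [t01 gt0] := St.
  have /gd : ball c d t.
    by rewrite /ball /= ger0_norm ?subr_ge0//; rewrite -/c in tc; lra.
  rewrite ler0_norm ?subr_le0// => gtc.
  rewrite -(subrKA (g t)) (le_trans (ler_normD _ _))//.
  rewrite distrC; lra.
have [c1|c1] := eqVneq c 1; first by have [_] := Sc; rewrite c1 mulr1.
have lec1 : c < 1 by rewrite lt_neqAle c1; case/andP: c01.
pose t := Num.min 1 (c + d / 2).
have ct : c < t by rewrite /t lt_min lec1/=; lra.
have tcd : t < c + d by rewrite /t gt_min; apply/orP; right; lra.
have t1 : t <= 1 by rewrite /t ge_min lexx.
have /gd : ball c d t by rewrite /ball /= distrC ger0_norm; lra.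
have tc0 : 0 <= t - c by lra.
rewrite (ger0_norm tc0) => gtc.
have : S t.
  split; first by case/andP: c01; lra.
  rewrite -(subrKA (g c)) (le_trans (ler_normD _ _))//.
  by have [_] := Sc; lra.
by move=> /(sup_upper_bound hS); rewrite -/c; lra.
Qed.

Lemma is_derive_increment (W : normedModType R) (g dg : R -> W) (M : R) :
  (forall c : R, 0 <= c <= 1 -> is_derive c 1 g (dg c)) ->
  (forall c : R, 0 <= c <= 1 -> `|dg c| <= M) ->
  `|g 1 - g 0| <= M.
Proof.
move=> gd dM; apply/ler_addgt0Pr => e e0; apply: local_slope_increment => c c01.
have [gc gE] := gd c c01.
move: gc; rewrite /derivable => /cvgrPdist_le; rewrite -/(derive g c 1) gE.
move=> /(_ _ e0); rewrite near_withinE => /nbhs_ballP[d /= d0 gd'].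
apply/nbhs_ballP; exists d => //= t ct.
have [->|tc] := eqVneq t c; first by rewrite !subrr !normr0 mulr0.
have tc0 : t - c != 0 by rewrite subr_eq0.
have := gd' (t - c); rewrite /ball /= sub0r normrN.
have -> : (t - c)%:A = t - c by rewrite /GRing.scale /= mulr1.
rewrite subrK distrC => /(_ ct tc0) h.
have -> : g t - g c = (t - c) *: ((t - c)^-1 *: (g t - g c)).
  by rewrite scalerA divff// scale1r.
rewrite normrZ [leLHS]mulrC (distrC c); apply: ler_wpM2r => //.
rewrite -[X in `|X|](subrK (dg c)) (le_trans (ler_normD _ _))// addrC lerD//.
  exact: dM.
by rewrite distrC.
Qed.

Lemma is_derive_line (U W : normedModType R) (f : U -> W) (x v : U) (t : R) :
  differentiable f (x + t *: v) ->
  is_derive t 1 (fun l => f (x + l *: v)) ('d f (x + t *: v) v).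
Proof.
move=> fd.
have lineD : is_diff t (fun l : R => x + l *: v) (fun l => l *: v).
  have -> : (fun l : R => x + l *: v) = cst x + *:%R ^~ v by [].
  have := is_diffD (is_diff_cst x (t : R)) (is_diff_scalel t v); rewrite add0r; exact.
have fD : is_diff (x + t *: v) f ('d f (x + t *: v)) by apply: DiffDef.
have [gd gE] := is_diff_comp lineD fD.
apply: DeriveDef; first exact: diff_derivable.
by rewrite deriveE// gE /= scale1r.
Qed.

(** ['d f x] is continuous when f is differentiable at x, hence is then its own
    image in the space of bounded operators. *)
Lemma frechetE (U W : normedModType R) (f : U -> W) (x : U) :
  differentiable f x -> frechet f x = 'd f x :> (U -> W).
Proof.
move=> fd; rewrite /frechet.
have h : ('d f x : U -> W) \in is_clin (U := U) (V := W).
  by rewrite inE; split; [exact: linearP|exact: diff_continuous].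
by have := insubdK (0 : clin U W) h.
Qed.

Lemma segment_cball (U : normedModType R) (c : U) (r : R) (x y : U) (t : R) :
  `|x - c| <= r -> `|y - c| <= r -> 0 <= t <= 1 ->
  `|y + t *: (x - y) - c| <= r.
Proof.
move=> xr yr /andP[t0 t1].
have -> : y + t *: (x - y) - c = t *: (x - c) + (1 - t) *: (y - c).
  by lin_module R.
rewrite (le_trans (ler_normD _ _))// !normrZ ger0_norm// ger0_norm ?subr_ge0//.
have -> : r = t * r + (1 - t) * r by ring.
by rewrite lerD// ler_wpM2l// subr_ge0.
Qed.

Section OnBall.
Context {U W : normedModType R} (f : U -> W) (c : U) (r : R).
Hypothesis fd : forall x, differentiable f x.

Lemma frechet_lipschitz (M : R) (x y : U) :
  (forall p, `|p - c| <= r -> `|frechet f p| <= M) ->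
  `|x - c| <= r -> `|y - c| <= r -> `|f x - f y| <= M * `|x - y|.
Proof.
move=> fM xr yr.
pose g (l : R) := f (y + l *: (x - y)).
have -> : f x - f y = g 1 - g 0.
  by rewrite /g scale1r scale0r addr0 (addrC y) subrK.
apply: (@is_derive_increment _ g
  (fun l => frechet f (y + l *: (x - y)) (x - y))) => l l01.
  by rewrite frechetE//; exact: is_derive_line.
apply: (le_trans (opnorm_bound _ _)); apply: ler_wpM2r => //.
by apply: fM; exact: segment_cball.
Qed.

(** The mean value inequality is applied to the difference of f along the
    segments from y to x and from y' to x'.  With p and q the two current
    points, its derivative is
      Df(p)((x - y) - (x' - y')) + (Df(p) - Df(q))(x' - y'). *)
Lemma frechet_four_point (M1 M2 : R) (x y x' y' : U) :
  (forall p, `|p - c| <= r -> `|frechet f p| <= M1) ->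
  (forall p q, `|p - c| <= r -> `|q - c| <= r ->
    `|frechet f p - frechet f q| <= M2 * `|p - q|) ->
  0 <= M2 ->
  `|x - c| <= r -> `|y - c| <= r -> `|x' - c| <= r -> `|y' - c| <= r ->
  `|(f x - f y) - (f x' - f y')| <=
    M1 * `|(x - y) - (x' - y')| + M2 * (`|x - x'| + `|y - y'|) * `|x' - y'|.
Proof.
move=> f1 f2 M20 xr yr xr' yr'.
pose p (l : R) := y + l *: (x - y).
pose q (l : R) := y' + l *: (x' - y').
pose g (l : R) := f (p l) - f (q l).
have -> : (f x - f y) - (f x' - f y') = g 1 - g 0.
  rewrite /g /p /q !scale1r !scale0r !addr0 (addrC y) (addrC y') !subrK.
  by lin_module R.
apply: (@is_derive_increment _ g (fun l => frechet f (p l) (x - y)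
   - frechet f (q l) (x' - y'))) => l l01.
  by rewrite !frechetE//; apply: is_deriveB; exact: is_derive_line.
have pr : `|p l - c| <= r by exact: segment_cball.
have qr : `|q l - c| <= r by exact: segment_cball.
have -> : frechet f (p l) (x - y) - frechet f (q l) (x' - y') =
    frechet f (p l) ((x - y) - (x' - y'))
    + (frechet f (p l) - frechet f (q l)) (x' - y').
  by rewrite [in RHS]linearB /= addrA subrK.
apply: (le_trans (ler_normD _ _)); apply: lerD.
  apply: (le_trans (opnorm_bound _ _)); apply: ler_wpM2r => //.
  exact: f1.
apply: (le_trans (opnorm_bound _ _)); apply: ler_wpM2r => //.
apply: (le_trans (f2 _ _ pr qr)); apply: ler_wpM2l => //.
have -> : p l - q l = l *: (x - x') + (1 - l) *: (y - y').
  by rewrite /p /q; lin_module R.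
apply: (le_trans (ler_normD _ _)); rewrite !normrZ.
case/andP: l01 => l0 l1; rewrite ger0_norm// ger0_norm ?subr_ge0//.
by apply: lerD; rewrite ler_piMl//; lra.
Qed.

End OnBall.
End MeanValue.

(** * Partitions of an interval, as increasing lists *)

Section Partitions.
Context {R : realType}.
Implicit Types (s t c d th : R) (p q : seq R).

Lemma path_lt_last s p : path <%R s p -> s <= last s p.
Proof.
by elim: p s => //= u p IH s /andP[/ltW su /IH]; exact: le_trans.
Qed.

Lemma split_path_at s c p : s <= c < last s p ->
  exists p1 v p2, [/\ p = p1 ++ v :: p2, last s p1 <= c & c < v].
Proof.
elim: p s => /= [s /andP[sc /(le_lt_trans sc)]|v p IH s /andP[sc cl]].
  by rewrite ltxx.
have [cv|vc] := ltP c v; first by exists [::], v, p.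
have [|p1 [w [p2 [-> h1 h2]]]] := IH v; first by rewrite vc.
by exists (v :: p1), w, p2.
Qed.

(** Cutting [s, t] at the last partition point before its midpoint leaves three
    pieces: a list on each side that covers at most half of the interval, and
    the single step across the midpoint. *)
Lemma split_path_half s p : path <%R s p -> p != [::] ->
  exists p1 v p2, [/\ p = p1 ++ v :: p2,
    [/\ path <%R s p1, last s p1 < v & path <%R v p2],
    last s p1 - s <= (last s p - s) / 2
    & last s p - v <= (last s p - s) / 2].
Proof.
case: p => // u p /= /andP[su pu] _.
have ul := path_lt_last pu.
have [|p1 [v [p2 [E h1 h2]]]] := @split_path_at s ((s + last u p) / 2) (u :: p).
  by rewrite /=; lra.
exists p1, v, p2; split=> //; [|by lra|by lra].
have : path <%R s (u :: p) by rewrite /= su.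
by rewrite E cat_path /= => /and3P[].
Qed.

(** [q] refines [p] block by block: each step of [p] is covered by a segment of
    [q].  Euler schemes are compared one coarse step at a time, and this
    presentation follows that induction. *)
Fixpoint refines s p q : Prop :=
  if p is u :: p' then
    exists q1 q2, [/\ q = q1 ++ q2, last s q1 = u & refines u p' q2]
  else q = [::].

(** The refinement is the merge of the two increasing lists. *)
Lemma common_refinement s p q : path <%R s p -> path <%R s q ->
  last s p = last s q ->
  exists r, [/\ path <%R s r, last s r = last s p, refines s p r
    & refines s q r].
Proof.
have [n] := ubnP (size p + size q); elim: n s p q => // n IH s [|u p] [|v q] //=.
- by move=> *; exists [::].
- by move=> _ _ /andP[sv /path_lt_last + E]; rewrite -E leNgt sv.
- by move=> _ /andP[sv /path_lt_last + _ E]; rewrite E leNgt sv.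
rewrite ltnS => pq /andP[su pu] /andP[sv pv] E.
case: (ltgtP u v) => uv.
- have [||||r [pr rp r1 r2]] := IH u p (v :: q); rewrite /= ?uv//.
  exists (u :: r); split => //=; first by rewrite su.
    by exists [:: u], r.
  have [q1 [q2 [-> q1v q2r]]] := r2.
  by exists (u :: q1), q2.
- have [||||r [pr rp r1 r2]] := IH v (u :: p) q; rewrite /= ?uv//.
    by move: pq; rewrite addSn addnS.
  exists (v :: r); split => //=; first by rewrite sv.
    have [q1 [q2 [-> q1v q2r]]] := r1.
    by exists (v :: q1), q2.
  by exists [:: v], r.
- subst v.
  have [||||r [pr rp r1 r2]] := IH u p q => //.
    by rewrite (leq_trans _ pq)// addSn ltnS leq_add2l.
  exists (u :: r); split => //=; first by rewrite su.
    by exists [:: u], r.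
  by exists [:: u], r.
Qed.

Definition gap_lt d : rel R := [rel a b | b - a < d].

Lemma fine_partition s t d : 0 < d -> s <= t ->
  exists2 p, itv_partition s t p & path (gap_lt d) s p.
Proof.
move=> d0; have [n] : exists n : nat, t - s < n%:R * (d / 2).
  have dd : 0 < d / 2 by lra.
  by exists (Num.truncn ((t - s) / (d / 2))).+1; rewrite -ltr_pdivrMr// truncnS_gt.
elim: n s => [|n IH] s; first by rewrite mul0r => ts st; exfalso; lra.
rewrite -natr1 mulrDl mul1r => ts st.
have [->|sNt] := eqVneq s t; first by exists [::]; rewrite /itv_partition.
have slt : s < t by rewrite lt_neqAle sNt.
have [tsd|dts] := ltP (t - s) d.
  by exists [:: t]; [exact: itv_partition1|rewrite /= /gap_lt/= tsd].
have [||p [p1 p2] p3] := IH (s + d / 2); [lra|lra|].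
exists (s + d / 2 :: p); first by rewrite /itv_partition /= p1 p2 andbT; split=> //; lra.
by rewrite /= p3 andbT /gap_lt /=; lra.
Qed.

(** The mesh condition, phrased as a path for the relation [gap_lt], splits along
    concatenations as partitions do. *)
Lemma partition_meshP s t (A : set (seq R)) :
  partition_mesh s t A <-> exists2 d, 0 < d &
    forall p, itv_partition s t p -> path (gap_lt d) s p -> A p.
Proof.
split=> -[d d0 h]; exists d => // p sp.
  by move=> /(pathP t) pd; apply: h => // k ks; exact: pd.
by move=> pd; apply: h => //; apply/(pathP t) => k ks; exact: pd.
Qed.

Lemma path_gap_lt_le d e s p : d <= e -> path (gap_lt d) s p ->
  path (gap_lt e) s p.
Proof.
by move=> de; apply: sub_path => a b; rewrite /gap_lt /= => /lt_le_trans; apply.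
Qed.

Lemma partition_mesh_filter s t : s <= t -> ProperFilter (partition_mesh s t).
Proof.
move=> st; split.
  move=> /partition_meshP[d d0 h]; have [p p1 p2] := fine_partition d0 st.
  exact: h p1 p2.
split.
- by apply/partition_meshP; exists 1.
- move=> A B /partition_meshP[d d0 hA] /partition_meshP[e e0 hB].
  apply/partition_meshP; exists (Num.min d e); first by rewrite lt_min d0.
  move=> p p1 p2; split.
    by apply: hA => //; apply: path_gap_lt_le p2; rewrite ge_min lexx.
  by apply: hB => //; apply: path_gap_lt_le p2; rewrite ge_min lexx orbT.
- move=> A B AB /partition_meshP[d d0 hA]; apply/partition_meshP; exists d => //.
  by move=> p p1 p2; apply: AB; exact: hA.
Qed.

(** The order of magnitude of the total error of a scheme over [p]. *)
Fixpoint powsum th s p : R :=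
  if p is u :: p' then (u - s) `^ th + powsum th u p' else 0.

(** Each gap satisfies (u - s)^th <= d^(th - 1) (u - s), and the gaps add up to
    the length of the interval. *)
Lemma powsum_le th d s p : 1 < th -> path <%R s p -> path (gap_lt d) s p ->
  powsum th s p <= d `^ (th - 1) * (last s p - s).
Proof.
move=> th1; elim: p s => [|u p IH] s /=; first by rewrite subrr mulr0.
rewrite /gap_lt /= => /andP[su pu] /andP[sd pd].
have -> : last u p - s = (u - s) + (last u p - u) by ring.
rewrite mulrDr lerD ?IH//.
have us : 0 < u - s by rewrite subr_gt0.
have -> : th = (th - 1) + 1 by rewrite subrK.
rewrite addrK powRD ?(gt_eqF us) ?implybT// (powRr1 (ltW us)).
rewrite ler_pM2r// ge0_ler_powR ?nnegrE//; lra.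
Qed.

Lemma powR_mesh_small th b e : 1 < th -> 0 <= b -> 0 < e ->
  exists2 d, 0 < d & d `^ (th - 1) * b < e.
Proof.
move=> th1 b0 e0; exists ((e / (b + 1)) `^ (th - 1)^-1).
  by rewrite powR_gt0 ?divr_gt0//; lra.
have t0 : th - 1 != 0 by rewrite gt_eqF; lra.
rewrite -powRrM mulVf// powRr1; last by rewrite divr_ge0; lra.
rewrite mulrAC ltr_pdivrMr; last lra.
by rewrite ltr_pM2l//; lra.
Qed.

Lemma powR_mono th a b : 0 <= th -> 0 <= a -> a <= b -> a `^ th <= b `^ th.
Proof.
by move=> t0 a0 ab; rewrite ge0_ler_powR ?nnegrE// (le_trans a0).
Qed.

Lemma powR_half th a b : 0 <= th -> 0 <= a -> a <= b / 2 ->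
  a `^ th <= 2^-1 `^ th * b `^ th.
Proof.
move=> th0 a0 ab; have b0 : 0 <= b by lra.
rewrite -powRM ?invr_ge0 ?ler0n//.
by rewrite ge0_ler_powR ?nnegrE//; lra.
Qed.

End Partitions.

(** * Euler schemes of an almost flow *)

Section EulerScheme.
Context {R : realType} {V : completeNormedModType R}.
Variable phi : R -> R -> V -> V.

Fixpoint euler s p x : V := if p is u :: p' then euler u p' (phi s u x) else x.

Lemma euler_cat s p q x : euler s (p ++ q) x = euler (last s p) q (euler s p x).
Proof. by elim: p s x => //= u p IH s x; exact: IH. Qed.

Variables (h th : R) (xi : V).

Definition defect s u t x := phi u t (phi s u x) - phi s t x.

(** All estimates are local: the centre is [xi], one step from the unit ball
    lands in the ball of radius 2, and the increments x |-> phi s t x - x are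
    controlled there up to second order.  The constant [e] is meant to be small
    (it is made so by shortening the time interval), while [K] and [C] are not. *)
Record almost_flow (e K C : R) : Prop := AlmostFlow {
  af_id : forall t x, 0 <= t <= h -> phi t t x = x ;
  af_small : forall s t x, 0 <= s -> s <= t -> t <= h -> `|x - xi| <= 1 ->
    `|phi s t x - x| <= 4^-1 ;
  af_lip : forall s t x y, 0 <= s -> s <= t -> t <= h ->
    `|x - xi| <= 2 -> `|y - xi| <= 2 ->
    `|(phi s t x - x) - (phi s t y - y)| <= e * `|x - y| ;
  af_four : forall s t x y x' y', 0 <= s -> s <= t -> t <= h ->
    `|x - xi| <= 2 -> `|y - xi| <= 2 -> `|x' - xi| <= 2 -> `|y' - xi| <= 2 ->
    `|((phi s t x - x) - (phi s t y - y))
      - ((phi s t x' - x') - (phi s t y' - y'))| <=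
    e * `|(x - y) - (x' - y')| + K * (`|x - x'| + `|y - y'|) * `|x' - y'| ;
  af_defect : forall s u t x, 0 <= s -> s <= u -> u <= t -> t <= h ->
    `|x - xi| <= 1 -> `|defect s u t x| <= C * (t - s) `^ th ;
  af_defect_lip : forall s u t x y, 0 <= s -> s <= u -> u <= t -> t <= h ->
    `|x - xi| <= 1 -> `|y - xi| <= 1 ->
    `|defect s u t x - defect s u t y| <= C * (t - s) `^ th * `|x - y| }.

(** [contrD] and [contrL] are the inequalities that close the inductions of
    [euler_davie] and [euler_diff]: the first term is the error inherited from
    the two halves of a partition, the others are the errors made when the
    halves are put together.  [smallD] keeps the schemes in the unit ball and
    [smallL] makes them Lipschitz with constant at most 1 + 2 e. *)
Variables (e K C D L : R).
Hypotheses (th1 : 1 < th) (e0 : 0 <= e) (e1 : e <= 1) (K0 : 0 <= K)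
  (C0 : 0 <= C) (D0 : 0 <= D) (L0 : 0 <= L).
Hypothesis AF : almost_flow e K C.
Hypothesis contrD : (2 + 6 * e) * (2^-1 `^ th * D) + 2 * C <= D.
Hypothesis contrL :
  (2 + 6 * e) * (2^-1 `^ th * L) + 4 * C + 4 * K * D <= L.
Hypothesis smallD : D * h `^ th <= 4^-1.
Hypothesis smallL : L * h `^ th <= e.

Let th0 : 0 <= th. Proof. exact: ltW (lt_trans ltr01 th1). Qed.

Lemma phi_ball2 s t x : 0 <= s -> s <= t -> t <= h ->
  `|x - xi| <= 1 -> `|phi s t x - xi| <= 2.
Proof.
move=> s0 st ths x1; rewrite (le_trans (ler_distD x _ _))//.
by have := af_small AF s0 st ths x1; lra.
Qed.

Lemma phi_lip s t x y : 0 <= s -> s <= t -> t <= h ->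
  `|x - xi| <= 2 -> `|y - xi| <= 2 ->
  `|phi s t x - phi s t y| <= (1 + e) * `|x - y|.
Proof.
move=> s0 st ths x2 y2.
have -> : phi s t x - phi s t y =
    (x - y) + ((phi s t x - x) - (phi s t y - y)) by lin_module R.
rewrite mulrDl mul1r (le_trans (ler_normD _ _))// lerD//.
by apply: (af_lip AF).
Qed.

(** Quantifying over prefixes makes this property pass to both halves of a
    concatenation. *)
Definition euler_in_ball s p x :=
  forall p1 p2, p = p1 ++ p2 -> `|euler s p1 x - xi| <= 1.

(** Sewing.  With the partition cut by [split_path_half] at m < v, replacing the
    scheme by single steps costs D ((t - s) / 2)^th on each half by induction,
    and regrouping the three steps costs two defects.  Since th > 1, the two
    halves together only use the fraction 2 * 2^-th < 1 of D (t - s)^th, which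
    leaves room for the defects and for the factor 1 + e coming from [phi_lip]. *)
Lemma euler_davie s p x : 0 <= s -> path <%R s p -> last s p <= h ->
  euler_in_ball s p x ->
  `|euler s p x - phi s (last s p) x| <= D * (last s p - s) `^ th.
Proof.
have [n] := ubnP (size p); elim: n s p x => // n IH s p x.
have [-> _ s0 _ sh _|p0] := eqVneq p [::].
  by rewrite /= (af_id AF) ?s0// !subrr normr0 powR0 ?mulr0// gt_eqF// (lt_trans ltr01).
rewrite ltnS => pn s0 sp lh xin.
have [p1 [v [p2 [E [sp1 mv vp2] h1 h2]]]] := split_path_half sp p0.
set t := last s p in lh h1 h2 *; set m := last s p1 in mv h1 *.
have lt : last v p2 = t by rewrite /t E last_cat.
have vt : v <= t by rewrite -lt path_lt_last.
have sm : s <= m by exact: path_lt_last.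
have p1n : (size p1 < n)%N.
  by rewrite (leq_trans _ pn)// E size_cat /= addnS ltnS leq_addr.
have p2n : (size p2 < n)%N.
  by rewrite (leq_trans _ pn)// E size_cat /= addnS ltnS leq_addl.
pose y := euler s p1 x; pose w := phi m v y.
have x1 : `|x - xi| <= 1 by apply: (xin [::] p).
have y1 : `|y - xi| <= 1 by apply: (xin p1 (v :: p2)).
have i1 : `|y - phi s m x| <= D * (m - s) `^ th.
  apply: IH => //; first exact: le_trans (ltW mv) (le_trans vt lh).
  by move=> q1 q2 Eq; apply: (xin q1 (q2 ++ v :: p2)); rewrite E Eq catA.
have i2 : `|euler v p2 w - phi v t w| <= D * (t - v) `^ th.
  rewrite -lt; apply: IH => //.
  - exact: le_trans s0 (le_trans sm (ltW mv)).
  - by rewrite lt.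
  - move=> q1 q2 Eq; have := xin (p1 ++ v :: q1) q2.
    by rewrite E Eq -catA /= euler_cat; apply.
have -> : euler s p x = euler v p2 w by rewrite E euler_cat.
have mt : m <= t by exact: le_trans (ltW mv) vt.
have b := af_defect AF (le_trans s0 sm) (ltW mv) vt lh y1.
have d := af_defect AF s0 sm mt lh x1.
have c := phi_lip (le_trans s0 sm) mt lh (le_trans y1 (ler1n _ 2))
  (phi_ball2 s0 sm (le_trans mt lh) x1).
have -> : euler v p2 w - phi s t x = (euler v p2 w - phi v t w)
    + defect m v t y + (phi m t y - phi m t (phi s m x)) + defect s m t x.
  by rewrite /defect /w; lin_module R.
have k1 : (m - s) `^ th <= 2^-1 `^ th * (t - s) `^ th.
  by rewrite powR_half ?subr_ge0.
have k2 : (t - v) `^ th <= 2^-1 `^ th * (t - s) `^ th.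
  by rewrite powR_half ?subr_ge0.
have k3 : (t - m) `^ th <= (t - s) `^ th.
  by rewrite powR_mono ?subr_ge0// lerD2l lerN2.
have T0 : 0 <= (t - s) `^ th by exact: powR_ge0.
have H0 : 0 <= 2^-1 `^ th :> R by exact: powR_ge0.
set T := (t - s) `^ th in k1 k2 k3 d T0 *; set H := 2^-1 `^ th in k1 k2 H0.
have {}i1 := le_trans i1 (ler_wpM2l D0 k1).
have {}i2 := le_trans i2 (ler_wpM2l D0 k2).
have {}b := le_trans b (ler_wpM2l C0 k3).
have e1' : 0 <= 1 + e by rewrite addr_ge0.
have {}c := le_trans c (ler_wpM2l e1' i1).
have g := ler_wpM2r T0 contrD.
have HD : 0 <= e * (H * D) * T by rewrite !mulr_ge0.
rewrite (le_trans (ler_normD _ _))// (le_trans (lerD (ler_normD _ _) (lexx _)))//.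
rewrite (le_trans (lerD (lerD (ler_normD _ _) (lexx _)) (lexx _)))//.
apply: le_trans g; rewrite -/H.
have -> : ((2 + 6 * e) * (H * D) + 2 * C) * T =
  D * (H * T) + C * T + (1 + e) * (D * (H * T)) + C * T + 5 * (e * (H * D) * T).
  by ring.
move: i2 b c d HD; rewrite -/T; lra.
Qed.

(** The condition under which schemes are compared.  Any scheme carries it to its
    final time ([trapped_euler]), as the inductions require. *)
Definition trapped s x :=
  forall p, path <%R s p -> last s p <= h -> `|euler s p x - xi| <= 1.

Lemma trapped_ball s x : s <= h -> trapped s x -> `|x - xi| <= 1.
Proof. by move=> sh /(_ [::]); apply. Qed.

Lemma trapped_in_ball s x p : trapped s x -> path <%R s p -> last s p <= h ->
  euler_in_ball s p x.
Proof.
move=> gx + + p1 p2 E; rewrite E cat_path last_cat => /andP[sp1 sp2] lh.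
by apply: gx => //; rewrite (le_trans _ lh)// path_lt_last.
Qed.

Lemma trapped_euler s x p : trapped s x -> path <%R s p ->
  trapped (last s p) (euler s p x).
Proof.
move=> gx sp q sq qh; rewrite -euler_cat; apply: gx; first by rewrite cat_path sp.
by rewrite last_cat.
Qed.

(** [euler_davie] needs the scheme to stay in the ball, and conversely forces it
    to: as long as it has stayed inside, it is within 1/4 of a single step from
    [xi], which moves by at most 1/4, and the next step adds at most 1/4.  Hence
    an induction on the number of steps. *)
Lemma euler_in_ball0 p : path <%R 0 p -> last 0 p <= h -> euler_in_ball 0 p xi.
Proof.
elim/last_ind: p => [_ _|p v IH].
  by move=> [|//] p2 _; rewrite /= subrr normr0.
rewrite rcons_path last_rcons => /andP[p0 pv] vh.
have lh : last 0 p <= h by rewrite (le_trans (ltW pv)).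
have l0 : 0 <= last 0 p by exact: path_lt_last.
have h0 : 0 <= h by exact: le_trans lh.
have {}IH := IH p0 lh.
move=> p1 p2; case/lastP: p2 => [|p2 w]; last first.
  by rewrite -rcons_cat => /eqP; rewrite eqseq_rcons => /andP[/eqP/IH].
rewrite cats0 => <-; rewrite -cats1 euler_cat /=.
have x1 : `|xi - xi| <= 1 by rewrite subrr normr0.
have a := euler_davie (lexx 0) p0 lh IH.
have b := af_small AF (lexx 0) l0 lh x1.
have y1 : `|euler 0 p xi - xi| <= 1 by apply: (IH p [::]); rewrite cats0.
have c := af_small AF l0 (ltW pv) vh y1.
have d : D * (last 0 p - 0) `^ th <= D * h `^ th.
  by rewrite ler_wpM2l// ge0_ler_powR ?nnegrE// subr0.
set y := euler 0 p xi in a c y1 *; set w := phi (last 0 p) v y in c *.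
set z := phi 0 (last 0 p) xi in a b.
have -> : w - xi = (w - y) + (y - z) + (z - xi) by lin_module R.
rewrite (le_trans (ler_normD _ _))// (le_trans (lerD (ler_normD _ _) (lexx _)))//.
by have := smallD; lra.
Qed.

Lemma trapped0 : trapped 0 xi.
Proof. by move=> p p0 ph; apply: (euler_in_ball0 p0 ph (p2 := [::])); rewrite cats0. Qed.

(** The argument of [euler_davie] for the difference of two schemes over the same
    partition.  The new ingredient is the comparison of phi_{m,t} at four
    points: the values X, Y of the schemes at time m and the values of single
    steps.  By [euler_davie] X and Y are D (t - s)^th close to the latter, so
    [af_four] contributes a multiple of (t - s)^th |x - y|. *)
Lemma euler_diff s p x y : 0 <= s -> path <%R s p -> last s p <= h ->
  trapped s x -> trapped s y ->
  `|(euler s p x - euler s p y) - (phi s (last s p) x - phi s (last s p) y)|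
    <= L * (last s p - s) `^ th * `|x - y|.
Proof.
(* Up to time m two schemes separate by a factor at most 1 + 2 e, hence by
   (1 + e) (1 + 2 e) up to time v. *)
have e3 : 1 + 2 * e <= 3 by move: e1; lra.
have e5 : (1 + e) * (1 + 2 * e) <= 1 + 5 * e by move: e0 e1; nra.
have e2 : 1 + e <= 2 by move: e1; lra.
have [n] := ubnP (size p); elim: n s p x y => // n IH s p x y.
have [-> _ s0 _ sh _ _|p0] := eqVneq p [::].
  rewrite /= !(af_id AF) ?s0// !subrr normr0 powR0 ?mulr0 ?mul0r// gt_eqF//.
  exact: lt_trans th1.
rewrite ltnS => pn s0 sp lh gx gy.
have [p1 [v [p2 [E [sp1 mv vp2] h1 h2]]]] := split_path_half sp p0.
set t := last s p in lh h1 h2 *; set m := last s p1 in mv h1 *.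
have lt : last v p2 = t by rewrite /t E last_cat.
have vt : v <= t by rewrite -lt path_lt_last.
have sm : s <= m by exact: path_lt_last.
have m0 : 0 <= m by exact: le_trans sm.
have mt : m <= t by exact: le_trans (ltW mv) vt.
have mh : m <= h by exact: le_trans lh.
have sh : s <= h by exact: le_trans mh.
have p1n : (size p1 < n)%N.
  by rewrite (leq_trans _ pn)// E size_cat /= addnS ltnS leq_addr.
have p2n : (size p2 < n)%N.
  by rewrite (leq_trans _ pn)// E size_cat /= addnS ltnS leq_addl.
pose X := euler s p1 x; pose Y := euler s p1 y.
have gX : trapped m X by exact: trapped_euler.
have gY : trapped m Y by exact: trapped_euler.
have mvp : path <%R m [:: v] by rewrite /= mv.
have gX' : trapped v (phi m v X) := trapped_euler gX mvp.
have gY' : trapped v (phi m v Y) := trapped_euler gY mvp.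
have x1 := trapped_ball sh gx; have y1 := trapped_ball sh gy.
have X1 := trapped_ball mh gX; have Y1 := trapped_ball mh gY.
have to2 (z : V) : `|z - xi| <= 1 -> `|z - xi| <= 2.
  by move=> /le_trans; apply; rewrite ler1n.
have x'2 : `|phi s m x - xi| <= 2 by exact: phi_ball2.
have y'2 : `|phi s m y - xi| <= 2 by exact: phi_ball2.
have i1 := IH _ _ _ _ p1n s0 sp1 mh gx gy; rewrite -/X -/Y -/m in i1.
have v0 : 0 <= v by exact: le_trans m0 (ltW mv).
have i2 : `|(euler v p2 (phi m v X) - euler v p2 (phi m v Y))
   - (phi v t (phi m v X) - phi v t (phi m v Y))|
   <= L * (t - v) `^ th * `|phi m v X - phi m v Y|.
  by rewrite -lt; apply: IH => //; rewrite lt.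
have a1 := euler_davie s0 sp1 mh (trapped_in_ball gx sp1 mh); rewrite -/X -/m in a1.
have a2 := euler_davie s0 sp1 mh (trapped_in_ball gy sp1 mh); rewrite -/Y -/m in a2.
have b := af_defect_lip AF m0 (ltW mv) vt lh X1 Y1.
have d := af_defect_lip AF s0 sm mt lh x1 y1.
have f := af_four AF m0 mt lh (to2 _ X1) (to2 _ Y1) x'2 y'2.
have l1 := phi_lip m0 (ltW mv) (le_trans vt lh) (to2 _ X1) (to2 _ Y1).
have l2 := phi_lip s0 sm mh (to2 _ x1) (to2 _ y1).
have -> : euler s p x = euler v p2 (phi m v X) by rewrite E euler_cat.
have -> : euler s p y = euler v p2 (phi m v Y) by rewrite E euler_cat.
have k1 : (m - s) `^ th <= 2^-1 `^ th * (t - s) `^ th.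
  by rewrite powR_half ?subr_ge0.
have k2 : (t - v) `^ th <= 2^-1 `^ th * (t - s) `^ th.
  by rewrite powR_half ?subr_ge0.
have k3 : (t - m) `^ th <= (t - s) `^ th.
  by rewrite powR_mono ?subr_ge0// lerD2l lerN2.
have k4 : (m - s) `^ th <= h `^ th.
  by rewrite powR_mono ?subr_ge0// (le_trans _ mh)// gerBl.
have k5 : (m - s) `^ th <= (t - s) `^ th.
  by rewrite powR_mono ?subr_ge0// lerD2r.
have T0 : 0 <= (t - s) `^ th by exact: powR_ge0.
have H0 : 0 <= 2^-1 `^ th :> R by exact: powR_ge0.
set T := (t - s) `^ th in k1 k2 k3 k5 d T0 *; set H := 2^-1 `^ th in k1 k2 H0.
set w := `|x - y| in i1 d l2 *; have w0 : 0 <= w by exact: normr_ge0.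
set N := (euler v p2 _ - _) - _ in i2 *.
set Q := X - Y - (phi s m x - phi s m y) in i1 f.
have q1 : `|Q| <= L * (H * T) * w.
  by rewrite (le_trans i1)// ler_wpM2r// ler_wpM2l.
have q2 : `|Q| <= e * w.
  rewrite (le_trans i1)// ler_wpM2r//.
  by rewrite (le_trans _ smallL)// ler_wpM2l.
have XY : `|X - Y| <= (1 + 2 * e) * w.
  have -> : X - Y = Q + (phi s m x - phi s m y) by rewrite /Q; lin_module R.
  rewrite (le_trans (ler_normD _ _))// (le_trans (lerD q2 l2))//.
  by have -> : e * w + (1 + e) * w = (1 + 2 * e) * w by ring.
have LHT0 : 0 <= L * (H * T) by rewrite !mulr_ge0.
have nN : `|N| <= L * (H * T) * ((1 + 5 * e) * w).
  rewrite (le_trans i2)// ler_pM ?mulr_ge0 ?powR_ge0 ?ler_wpM2l//.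
  rewrite (le_trans l1)//.
  apply: le_trans (ler_wpM2r w0 e5); rewrite -mulrA ler_wpM2l// addr_ge0//.
have nb : `|defect m v t X - defect m v t Y| <= C * T * (3 * w).
  rewrite (le_trans b)// ler_pM ?mulr_ge0 ?powR_ge0 ?ler_wpM2l//.
  by rewrite (le_trans XY)// ler_wpM2r.
set F := (_ - (_ - _)) in f.
have nF : `|F| <= e * (L * (H * T) * w) + K * (2 * D * T) * (2 * w).
  rewrite (le_trans f)// lerD ?ler_wpM2l//.
  have aa : `|X - phi s m x| + `|Y - phi s m y| <= 2 * D * T.
    rewrite -mulrA mulr_natl mulr2n lerD//.
      by rewrite (le_trans a1)// ler_wpM2l.
    by rewrite (le_trans a2)// ler_wpM2l.
  rewrite ler_pM ?mulr_ge0 ?addr_ge0 ?ler_wpM2l//.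
  by rewrite (le_trans l2)// ler_wpM2r.
have -> : euler v p2 (phi m v X) - euler v p2 (phi m v Y)
    - (phi s t x - phi s t y) =
    N + (defect m v t X - defect m v t Y) + F + Q
    + (defect s m t x - defect s m t y).
  by rewrite /N /F /Q /defect; lin_module R.
have g := ler_wpM2r (mulr_ge0 T0 w0) contrL.
rewrite [leRHS]mulrAC -mulrA [w * T]mulrC; apply: le_trans g.
rewrite (le_trans (ler_normD _ _))//.
rewrite (le_trans (lerD (ler_normD _ _) (lexx _)))//.
rewrite (le_trans (lerD (lerD (ler_normD _ _) (lexx _)) (lexx _)))//.
rewrite (le_trans (lerD (lerD (lerD (ler_normD _ _) (lexx _)) (lexx _)) (lexx _)))//.
move: nN nb nF q1 d; rewrite -/H; lra.
Qed.

Lemma euler_lip s p x y : 0 <= s -> path <%R s p -> last s p <= h ->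
  trapped s x -> trapped s y -> `|euler s p x - euler s p y| <= 3 * `|x - y|.
Proof.
move=> s0 sp lh gx gy; have sl := path_lt_last sp.
have sh : s <= h by exact: le_trans lh.
have a := euler_diff s0 sp lh gx gy.
have to2 (z : V) : `|z - xi| <= 1 -> `|z - xi| <= 2.
  by move=> /le_trans; apply; rewrite ler1n.
have b := phi_lip s0 sl lh (to2 _ (trapped_ball sh gx)) (to2 _ (trapped_ball sh gy)).
have c : L * (last s p - s) `^ th * `|x - y| <= e * `|x - y|.
  rewrite ler_wpM2r// (le_trans _ smallL)// ler_wpM2l// ge0_ler_powR ?nnegrE//.
  - by rewrite subr_ge0.
  - by rewrite (le_trans _ lh) ?(le_trans s0).
  - by rewrite (le_trans _ lh)// gerBl.
set u := phi s _ x - _ in a b.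
rewrite -(subrK u (euler s p x - _)) (le_trans (ler_normD _ _))//.
have w0 : 0 <= `|x - y| by [].
have d : e * `|x - y| <= `|x - y| by rewrite ler_piMl.
move: a b c d; lra.
Qed.

(** Telescoping over the steps of the coarse partition: on each of them the fine
    scheme and the coarse step differ by [euler_davie], and the coarse scheme
    carries this error to the end with a factor 3 by [euler_lip]. *)
Lemma euler_refine s p q x : 0 <= s -> path <%R s p -> path <%R s q ->
  last s q <= h -> trapped s x -> refines s p q ->
  `|euler s q x - euler s p x| <= 3 * D * powsum th s p.
Proof.
elim: p s q x => [|u p IH] s q x s0 sp sq qh gx /=.
  by move=> ->; rewrite subrr normr0 mulr0.
move=> [q1 [q2 [E q1u upq]]]; move: sp => /= /andP[su up].
move: sq qh; rewrite E cat_path last_cat q1u => /andP[sq1 uq2] q2h.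
have u0 : 0 <= u by rewrite (le_trans s0)// ltW.
have uh : u <= h by rewrite (le_trans _ q2h)// path_lt_last.
have g1 : trapped u (euler s q1 x) by rewrite -q1u; exact: trapped_euler.
have g2 : trapped u (phi s u x).
  have su1 : path <%R s [:: u] by rewrite /= su.
  exact: (trapped_euler gx su1).
have lup : last u p = last u q2.
  elim: p u q2 upq {IH su up g1 g2 q1u u0 uh sq1 E q2h uq2} => [|v p IH] u q2 /=.
    by move=> ->.
  by move=> [r1 [r2 [-> <- /IH]]]; rewrite last_cat.
rewrite euler_cat q1u.
have a := IH u q2 (euler s q1 x) u0 up uq2 q2h g1 upq.
have lh : last u p <= h by rewrite lup.
have b := euler_lip u0 up lh g1 g2.
have c : `|euler s q1 x - phi s u x| <= D * (u - s) `^ th.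
  have q1h : last s q1 <= h by rewrite q1u.
  by have := euler_davie s0 sq1 q1h (trapped_in_ball gx sq1 q1h); rewrite q1u.
rewrite -(subrK (euler u p (euler s q1 x)) (euler u q2 _)) -addrA.
rewrite (le_trans (ler_normD _ _))//.
move: a b c; lra.
Qed.

Lemma euler_cauchy t (ep : R) : 0 <= t -> t <= h -> 0 < ep ->
  exists2 d, 0 < d & forall p q, itv_partition 0 t p -> path (gap_lt d) 0 p ->
    itv_partition 0 t q -> path (gap_lt d) 0 q ->
    `|euler 0 p xi - euler 0 q xi| < ep.
Proof.
move=> t0 tht ep0; have b0 : 0 <= 3 * D * t by rewrite !mulr_ge0.
have ep2 : 0 < ep / 2 by rewrite divr_gt0.
have [d d0 dep] := powR_mesh_small th1 b0 ep2.
exists d => // p q [pp /eqP pl] pd [qp /eqP ql] qd.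
have [|r [rr rl rp rq]] := common_refinement pp qp; first by rewrite pl ql.
have rh : last 0 r <= h by rewrite rl pl.
have one u : path <%R 0 u -> last 0 u = t -> path (gap_lt d) 0 u ->
    refines 0 u r -> `|euler 0 r xi - euler 0 u xi| < ep / 2.
  move=> up ul ud ur; apply: le_lt_trans dep.
  rewrite (le_trans (euler_refine (lexx 0) up rr rh trapped0 ur))//.
  rewrite mulrCA ler_wpM2l ?mulr_ge0//.
  by have := powsum_le th1 up ud; rewrite ul subr0.
rewrite (le_lt_trans (ler_distD (euler 0 r xi) _ _))// [ep]splitr ltrD//.
  by rewrite distrC; exact: one.
exact: one.
Qed.

Definition euler_limit t : V :=
  lim ((fun p => euler 0 p xi) @ partition_mesh 0 t).

(** Convergence along the filter of fine partitions: Cauchy by [euler_cauchy],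
    and V is complete. *)
Lemma euler_limitP t (ep : R) : 0 <= t -> t <= h -> 0 < ep ->
  exists2 d, 0 < d & forall p, itv_partition 0 t p -> path (gap_lt d) 0 p ->
    `|euler_limit t - euler 0 p xi| < ep.
Proof.
move=> t0 tht ep0; have PF := partition_mesh_filter t0.
have : cvg ((fun p => euler 0 p xi) @ partition_mesh 0 t).
  apply: cauchy_cvg; apply: cauchy_exP => r r0.
  have [d d0 dP] := euler_cauchy t0 tht r0.
  have [p p1 p2] := fine_partition d0 t0.
  exists (euler 0 p xi); apply/partition_meshP; exists d => // q q1 q2.
  by rewrite /= -ball_normE /=; exact: dP.
by move=> /cvgrPdist_lt/(_ _ ep0)/partition_meshP.
Qed.

(** Partitions of [0, t] through s are enough to compute the limit at t.  Along
    them [euler_davie] applies on [s, t] from the value of the scheme at s, and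
    phi_{s,t} is continuous. *)
Lemma euler_limit_davie s t : 0 <= s -> s <= t -> t <= h ->
  `|euler_limit s - xi| <= 1 /\
  `|euler_limit t - phi s t (euler_limit s)| <= D * (t - s) `^ th.
Proof.
move=> s0 st tht; have sh : s <= h by exact: le_trans tht.
have t0 : 0 <= t by exact: le_trans st.
have approx (r : R) : 0 < r -> exists p q, [/\ itv_partition 0 s p,
    itv_partition s t q, `|euler_limit s - euler 0 p xi| < r &
    `|euler_limit t - euler 0 (p ++ q) xi| < r].
  move=> r0; have [d d0 dP] := euler_limitP s0 sh r0.
  have [d' d'0 dP'] := euler_limitP t0 tht r0.
  have m0 : 0 < Num.min d d' by rewrite lt_min d0.
  have [p p1 p2] := fine_partition m0 s0.
  have [q q1 q2] := fine_partition m0 st.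
  exists p, q; split => //.
    by apply: dP => //; apply: path_gap_lt_le p2; rewrite ge_min lexx.
  apply: dP'; first exact: itv_partition_cat p1 q1.
  rewrite cat_path; case: (p1) => _ /eqP ->; rewrite (path_gap_lt_le _ p2).
    by apply: path_gap_lt_le q2; rewrite ge_min lexx orbT.
  by rewrite ge_min lexx orbT.
have s1 : `|euler_limit s - xi| <= 1.
  apply/ler_addgt0Pr => r r0; have [p [q [[p1 /eqP pl] _ sp _]]] := approx r r0.
  rewrite (le_trans (ler_distD (euler 0 p xi) _ _))// addrC lerD//; last exact: ltW.
  by apply: trapped0 => //; rewrite pl.
split=> //; apply/ler_addgt0Pr => r r0.
have r4 : 0 < r / 4 by rewrite divr_gt0.
have [p [q [[p1 /eqP pl] [q1 /eqP ql] sp tpq]]] := approx _ r4.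
have lh : last 0 p <= h by rewrite pl.
have qh : last s q <= h by rewrite ql.
have gp : trapped s (euler 0 p xi).
  by rewrite -[X in trapped X]pl; exact: trapped_euler trapped0 _.
have a := euler_davie s0 q1 qh (trapped_in_ball gp q1 qh); rewrite ql in a.
have to2 (z : V) : `|z - xi| <= 1 -> `|z - xi| <= 2.
  by move=> /le_trans; apply; rewrite ler1n.
have b := phi_lip s0 st tht (to2 _ (trapped_ball sh gp)) (to2 _ s1).
have c : (1 + e) * `|euler 0 p xi - euler_limit s| <= 2 * (r / 4).
  rewrite ler_pM//; [exact: addr_ge0|by move: e1; lra|by rewrite distrC ltW].
rewrite euler_cat pl in tpq.
set y := euler 0 p xi in a b c tpq.
have -> : euler_limit t - phi s t (euler_limit s) =
    (euler_limit t - euler s q y) + (euler s q y - phi s t y)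
    + (phi s t y - phi s t (euler_limit s)) by lin_module R.
rewrite (le_trans (ler_normD _ _))// (le_trans (lerD (ler_normD _ _) (lexx _)))//.
move: a b c tpq; lra.
Qed.

End EulerScheme.

(** * Maps with bounded derivatives on a ball *)

Section Cn_bounded.
Context {R : realType} {U V : normedModType R}.
Implicit Types (g : U -> V) (c x y : U) (r m : R).

(** The derivatives exist everywhere but are only bounded on a ball: the weights
    (1 + |x|)^beta do not allow more. *)
Definition Cn_bounded n g c r m : Prop :=
  (forall k, (k < n)%N -> forall x, differentiable (iter_frechet k g) x) /\
  (forall k, (k <= n)%N -> forall x, `|x - c| <= r ->
    `|iter_frechet k g x| <= m).

Lemma iter_frechet0 k x : iter_frechet k (fun _ : U => 0 : V) x = 0.
Proof.
elim: k x => //= k IH x.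
have -> : iter_frechet k (fun _ : U => 0 : V) = cst 0 by apply/funext.
apply: val_inj; rewrite /= frechetE; last exact: differentiable_cst.
by rewrite diff_cst.
Qed.

Lemma Cn_bounded0 n c r m : 0 <= m -> Cn_bounded n (fun _ : U => 0 : V) c r m.
Proof.
move=> m0; split=> k _ x.
  rewrite (_ : iter_frechet k _ = cst 0); first exact: differentiable_cst.
  by apply/funext => z; rewrite iter_frechet0.
by rewrite iter_frechet0 normr0.
Qed.

Lemma iter_frechetB n (f g : U -> V) :
  (forall k, (k < n)%N -> forall x, differentiable (iter_frechet k f) x) ->
  (forall k, (k < n)%N -> forall x, differentiable (iter_frechet k g) x) ->
  forall k, (k <= n)%N ->
  iter_frechet k (fun x => f x - g x) = iter_frechet k f - iter_frechet k g.
Proof.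
move=> fd gd; elim=> [//|k IH] kn; apply/funext => x /=.
have dB := differentiableB (fd _ kn x) (gd _ kn x).
rewrite (IH (ltnW kn)); apply: val_inj; apply/funext => v /=.
have E1 := frechetE dB; have E2 := diffB (fd _ kn x) (gd _ kn x).
transitivity ('d (iter_frechet k f - iter_frechet k g) x v); first by rewrite -E1.
by rewrite E2 -(frechetE (fd _ kn x)) -(frechetE (gd _ kn x)).
Qed.

Lemma Cn_bounded_weaken n g c r m m' : m <= m' ->
  Cn_bounded n g c r m -> Cn_bounded n g c r m'.
Proof.
by move=> mm' [gd gm]; split=> // k kn x xr; exact: le_trans (gm k kn x xr) mm'.
Qed.

Section Bounds.
Variables (g : U -> V) (c : U) (r m : R).

Lemma Cn_bounded_le x n : Cn_bounded n g c r m -> `|x - c| <= r -> `|g x| <= m.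
Proof. by move=> [_ /(_ 0%N isT x)]. Qed.

Lemma Cn_bounded_lip n x y : Cn_bounded n.+1 g c r m ->
  `|x - c| <= r -> `|y - c| <= r ->
  `|g x - g y| <= m * `|x - y|.
Proof.
move=> [gd gm]; move=> xr yr.
apply: (frechet_lipschitz (c := c) (r := r) (gd 0%N isT)) => //.
by move=> p pr; refine (gm 1%N isT p pr).
Qed.

Lemma Cn_bounded_frechet_le n x v : Cn_bounded n.+1 g c r m -> `|x - c| <= r ->
  `|frechet g x v| <= m * `|v|.
Proof.
move=> [gd gm] xr; rewrite (le_trans (opnorm_bound _ _))//.
rewrite ler_wpM2r//; refine (gm 1%N isT x xr).
Qed.

Lemma Cn_bounded_frechet_lip n x y v : Cn_bounded n.+2 g c r m ->
  `|x - c| <= r -> `|y - c| <= r ->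
  `|frechet g x v - frechet g y v| <= m * `|x - y| * `|v|.
Proof.
move=> [gd gm] xr yr.
apply: le_trans (opnorm_bound (frechet g x - frechet g y) v) _.
rewrite ler_wpM2r//.
apply: (@frechet_lipschitz _ _ _ (frechet g) c r (gd 1%N isT)) => //.
by move=> p pr; refine (gm 2%N isT p pr).
Qed.

Lemma Cn_bounded_four_point n x y x' y' : Cn_bounded n.+2 g c r m ->
  `|x - c| <= r -> `|y - c| <= r -> `|x' - c| <= r -> `|y' - c| <= r ->
  `|(g x - g y) - (g x' - g y')| <=
    m * (`|(x - y) - (x' - y')| + (`|x - x'| + `|y - y'|) * `|x' - y'|).
Proof.
move=> gC xr yr xr' yr'; have [gd gm] := gC.
have m0 : 0 <= m by rewrite (le_trans _ (Cn_bounded_le gC xr)).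
rewrite mulrDr mulrA; apply: (frechet_four_point (c := c) (r := r) (gd 0%N isT)) => //.
  by move=> p pr; refine (gm 1%N isT p pr).
move=> p q pr qr.
apply: (@frechet_lipschitz _ _ _ (frechet g) c r (gd 1%N isT)) => //.
by move=> z zr; refine (gm 2%N isT z zr).
Qed.

(** The bound on the third derivative is the Lipschitz constant of the second,
    as [frechet_four_point] for x |-> Dg(x) requires. *)
Lemma Cn_bounded_frechet_four_point n x y x' y' v : Cn_bounded n.+3 g c r m ->
  `|x - c| <= r -> `|y - c| <= r -> `|x' - c| <= r -> `|y' - c| <= r ->
  `|(frechet g x v - frechet g y v) - (frechet g x' v - frechet g y' v)| <=
    m * (`|(x - y) - (x' - y')| + (`|x - x'| + `|y - y'|) * `|x' - y'|) * `|v|.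
Proof.
move=> gC xr yr xr' yr'; have [gd gm] := gC.
have m0 : 0 <= m by rewrite (le_trans _ (Cn_bounded_le gC xr)).
apply: le_trans (opnorm_bound
  ((frechet g x - frechet g y) - (frechet g x' - frechet g y')) v) _.
rewrite ler_wpM2r// mulrDr mulrA.
apply: (@frechet_four_point _ _ _ (frechet g) c r (gd 1%N isT)) => //.
  by move=> p pr'; refine (gm 2%N isT p pr').
move=> p q pr qr.
apply: (@frechet_lipschitz _ _ _ (frechet (frechet g)) c r (gd 2%N isT)) => //.
by move=> z zr; refine (gm 3%N isT z zr).
Qed.

Definition taylor1 (g : U -> V) x v := g (x + v) - g x - frechet g x v.

(** Both remainders are followed along l |-> x + l v and l |-> y + l w.  The
    derivative of their difference is
      (Dg(x + l v) - Dg(x)) v - (Dg(y + l w) - Dg(y)) w,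
    which splits into a four-point difference of Dg applied to v and an
    increment of Dg applied to v - w. *)
Lemma taylor1_diff n x y v w : Cn_bounded n.+3 g c r m ->
  `|x - c| <= r -> `|y - c| <= r -> `|x + v - c| <= r -> `|y + w - c| <= r ->
  `|taylor1 g x v - taylor1 g y w| <=
    m * (`|v - w| + (`|v| + `|w|) * `|x - y|) * `|v| + m * `|w| * `|v - w|.
Proof.
move=> gC xr yr xr' yr'; have [gd gm] := gC.
have m0 : 0 <= m by rewrite (le_trans _ (Cn_bounded_le gC xr)).
pose k (l : R) := (g (x + l *: v) - l *: frechet g x v)
   - (g (y + l *: w) - l *: frechet g y w).
have -> : taylor1 g x v - taylor1 g y w = k 1 - k 0.
  by rewrite /taylor1 /k !scale1r !scale0r !addr0; lin_module R.
apply: (@is_derive_increment _ _ k (fun l =>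
   (frechet g (x + l *: v) v - frechet g x v)
   - (frechet g (y + l *: w) w - frechet g y w))) => l l01.
  have gd0 : forall z, differentiable g z := gd 0%N isT.
  have lin (z : V) : is_derive l 1 (fun l : R => l *: z) z.
    have sd := is_diff_scalel l z.
    apply: DeriveDef; first exact/diff_derivable/(@ex_diff _ _ _ _ _ _ _ sd).
    by rewrite deriveE ?diff_val ?scale1r//; exact: (@ex_diff _ _ _ _ _ _ _ sd).
  apply: is_deriveB; apply: is_deriveB; rewrite frechetE//.
  - exact: is_derive_line.
  - exact: is_derive_line.
have ball z u : `|z - c| <= r -> `|z + u - c| <= r -> `|z + l *: u - c| <= r.
  move=> zr ur; have := segment_cball ur zr l01.
  by rewrite (_ : z + u - z = u) //; lin_module R.
have xl := ball _ _ xr xr'; have yl := ball _ _ yr yr'.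
have -> : (frechet g (x + l *: v) v - frechet g x v)
   - (frechet g (y + l *: w) w - frechet g y w) =
   ((frechet g (x + l *: v) v - frechet g (y + l *: w) v)
     - (frechet g x v - frechet g y v))
   + (frechet g (y + l *: w) (v - w) - frechet g y (v - w)).
  by rewrite !linearB /=; lin_module R.
have l0 : 0 <= l by case/andP: l01.
have l1 : `|l| <= 1 by rewrite ger0_norm//; case/andP: l01.
have scl (z : U) : `|l *: z| <= `|z| by rewrite normrZ ler_piMl.
rewrite (le_trans (ler_normD _ _))// lerD//.
  apply: le_trans (Cn_bounded_frechet_four_point _ gC xl yl xr yr) _.
  rewrite ler_wpM2r// ler_wpM2l// lerD//.
    by rewrite (_ : _ - _ = l *: (v - w)) ?scl//; lin_module R.
  by rewrite ler_wpM2r// lerD// addrC addKr scl.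
apply: le_trans (Cn_bounded_frechet_lip _ gC yl yr) _.
by rewrite ler_wpM2r// ler_wpM2l// addrC addKr scl.
Qed.

Lemma taylor1_le n x v : Cn_bounded n.+3 g c r m ->
  `|x - c| <= r -> `|x + v - c| <= r ->
  `|taylor1 g x v| <= m * `|v| * `|v|.
Proof.
move=> gC xr xr'.
have -> : taylor1 g x v = taylor1 g x v - taylor1 g x 0.
  by rewrite /taylor1 addr0 subrr linear0 subr0 subr0.
have := @taylor1_diff n x x v 0 gC xr xr xr'; rewrite addr0 => /(_ xr).
by rewrite subr0 subrr normr0 !mulr0 mul0r !addr0.
Qed.

End Bounds.
End Cn_bounded.

(** * The Euler step of a nonlinear rough path is an almost flow *)

Section Diagonal.
Context {R : realType} {V : normedModType R}.
Implicit Types (x y : V).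

Definition diag x : sumprod V V := (x, x).

Lemma norm_diagB x y : `|diag x - diag y| = 2 * `|x - y|.
Proof. by rewrite mulr_natl mulr2n. Qed.

Lemma norm_diag4 x y x' y' :
  `|(diag x - diag y) - (diag x' - diag y')| = 2 * `|(x - y) - (x' - y')|.
Proof. by rewrite mulr_natl mulr2n. Qed.

Section Expansion.
Variables (g : V -> V) (G : sumprod V V -> V) (xi : V) (m1 m2 : R).
Hypotheses (gC : Cn_bounded 3 g xi 2 m1) (GC : Cn_bounded 2 G (diag xi) 4 m2).

Let diag4 x : `|x - xi| <= 2 -> `|diag x - diag xi| <= 4.
Proof. by rewrite norm_diagB; lra. Qed.

(** With [g] and [G] the two levels of the rough path over one time interval, the
    increment of the Euler step is x |-> g x + G (x, x). *)
Lemma expansion_le x : `|x - xi| <= 2 -> `|g x + G (diag x)| <= m1 + m2.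
Proof.
move=> x2; rewrite (le_trans (ler_normD _ _))// lerD//.
  exact: Cn_bounded_le gC _.
by apply: Cn_bounded_le GC _; exact: diag4.
Qed.

Lemma expansion_four x y x' y' :
  `|x - xi| <= 2 -> `|y - xi| <= 2 -> `|x' - xi| <= 2 -> `|y' - xi| <= 2 ->
  `|((g x + G (diag x)) - (g y + G (diag y)))
    - ((g x' + G (diag x')) - (g y' + G (diag y')))| <=
  (m1 + 2 * m2) * `|(x - y) - (x' - y')|
  + (m1 + 4 * m2) * (`|x - x'| + `|y - y'|) * `|x' - y'|.
Proof.
move=> x2 y2 x'2 y'2.
have a := Cn_bounded_four_point gC x2 y2 x'2 y'2.
have := Cn_bounded_four_point GC (diag4 x2) (diag4 y2) (diag4 x'2) (diag4 y'2).
rewrite norm_diag4 !norm_diagB => b.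
have -> : ((g x + G (diag x)) - (g y + G (diag y)))
    - ((g x' + G (diag x')) - (g y' + G (diag y'))) =
   ((g x - g y) - (g x' - g y')) +
   ((G (diag x) - G (diag y)) - (G (diag x') - G (diag y'))).
  by lin_module R.
rewrite (le_trans (ler_normD _ _))// (le_trans (lerD a b))//.
by rewrite le_eqVlt; apply/orP; left; apply/eqP; ring.
Qed.

Lemma expansion_lip x y : `|x - xi| <= 2 -> `|y - xi| <= 2 ->
  `|(g x + G (diag x)) - (g y + G (diag y))| <= (m1 + 2 * m2) * `|x - y|.
Proof.
move=> x2 y2; have := expansion_four x2 y2 y2 y2.
by rewrite !(subrr, subr0, normr0, mulr0, addr0).
Qed.

(** The value at [x] of the defect of the Euler step, with [g], [G] the two levels
    of the rough path on [u, t], [a] the Euler increment on [s, u] and [b] its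
    second order part: see [rough_step_defect]. *)
Definition remainder x a b :=
  taylor1 g x a + frechet g x b + (G (diag (x + a)) - G (diag x)).

Lemma remainder_le x a b : `|x - xi| <= 2 -> `|x + a - xi| <= 2 ->
  `|remainder x a b| <= m1 * `|a| * `|a| + m1 * `|b| + m2 * (2 * `|a|).
Proof.
move=> x2 xa2; rewrite (le_trans (ler_normD _ _))// lerD//.
  rewrite (le_trans (ler_normD _ _))// lerD//; first exact: taylor1_le gC _ _.
  exact: Cn_bounded_frechet_le gC _.
apply: le_trans (Cn_bounded_lip GC (diag4 xa2) (diag4 x2)) _.
by rewrite norm_diagB addrC addKr.
Qed.

Lemma remainder_lip x y a b a' b' :
  `|x - xi| <= 2 -> `|y - xi| <= 2 -> `|x + a - xi| <= 2 ->
  `|y + a' - xi| <= 2 ->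
  `|remainder x a b - remainder y a' b'| <=
    (m1 * (`|a - a'| + (`|a| + `|a'|) * `|x - y|) * `|a|
       + m1 * `|a'| * `|a - a'|)
    + (m1 * `|x - y| * `|b| + m1 * `|b - b'|)
    + m2 * (2 * `|a - a'| + (2 * `|a| + 2 * `|a'|) * (2 * `|x - y|)).
Proof.
move=> x2 y2 xa2 ya2.
have t1 := taylor1_diff gC x2 y2 xa2 ya2.
have t2 := Cn_bounded_frechet_lip b gC x2 y2.
have t3 := Cn_bounded_frechet_le (b - b') gC y2.
have := Cn_bounded_four_point GC (diag4 xa2) (diag4 ya2) (diag4 x2) (diag4 y2).
rewrite norm_diag4 !norm_diagB.
have -> : x + a - (y + a') - (x - y) = a - a' by lin_module R.
rewrite [x + a - x]addrC addKr [y + a' - y]addrC addKr => t4.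
have -> : remainder x a b - remainder y a' b' =
   (taylor1 g x a - taylor1 g y a')
   + ((frechet g x b - frechet g y b) + frechet g y (b - b'))
   + ((G (diag (x + a)) - G (diag (y + a'))) - (G (diag x) - G (diag y))).
  have -> : frechet g y (b - b') = frechet g y b - frechet g y b' by exact: linearB.
  by rewrite /remainder; lin_module R.
rewrite (le_trans (ler_normD _ _))// lerD//.
rewrite (le_trans (ler_normD _ _))// lerD//.
by rewrite (le_trans (ler_normD _ _))// lerD.
Qed.

End Expansion.
End Diagonal.

Section DefectConstants.
Context {R : realType}.
Variables (M w : R).
Hypotheses (M0 : 0 <= M) (w0 : 0 <= w).

(** Here [w] stands for (t - s)^alpha, [A] bounds the Euler increment and [B] its
    second order part; every term is then cubic in [w]. *)
Lemma defect_num A B : 0 <= A -> 0 <= B -> A <= 2 * M * w -> B <= M * w ^+ 2 ->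
  M * w * A * A + M * w * B + M * w ^+ 2 * (2 * A)
    <= 30 * (M ^+ 3 + M ^+ 2) * w ^+ 3.
Proof.
move=> A0 B0 A1 B1; have AA := ler_pM A0 A0 A1 A1.
have Mw : 0 <= M * w by rewrite mulr_ge0.
have Mw2 : 0 <= M * w ^+ 2 by rewrite mulr_ge0// exprn_ge0.
have a := ler_wpM2l Mw AA; have b := ler_wpM2l Mw B1; have c := ler_wpM2l Mw2 A1.
have p3 : 0 <= M ^+ 3 * w ^+ 3 by rewrite mulr_ge0 ?exprn_ge0.
have p2 : 0 <= M ^+ 2 * w ^+ 3 by rewrite mulr_ge0 ?exprn_ge0.
by lra.
Qed.

Lemma defect_lip_num A A' B dA dB d : 0 <= A -> 0 <= A' -> 0 <= B ->
  0 <= dA -> 0 <= dB -> 0 <= d ->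
  A <= 2 * M * w -> A' <= 2 * M * w -> B <= M * w ^+ 2 ->
  dA <= 3 * M * w * d -> dB <= 2 * M * w ^+ 2 * d ->
  (M * w * (dA + (A + A') * d) * A + M * w * A' * dA)
  + (M * w * d * B + M * w * dB)
  + M * w ^+ 2 * (2 * dA + (2 * A + 2 * A') * (2 * d))
    <= 30 * (M ^+ 3 + M ^+ 2) * w ^+ 3 * d.
Proof.
move=> A0 A'0 B0 dA0 dB0 d0 A1 A'1 B1 dA1 dB1.
have Mw : 0 <= M * w by rewrite mulr_ge0.
have Mw2 : 0 <= M * w ^+ 2 by rewrite mulr_ge0// exprn_ge0.
have AA : A + A' <= 4 * M * w by lra.
have q1 : dA + (A + A') * d <= 7 * M * w * d by have := ler_wpM2r d0 AA; lra.
have q10 : 0 <= dA + (A + A') * d by rewrite addr_ge0// mulr_ge0// addr_ge0.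
have q2 := ler_wpM2l Mw (ler_pM q10 A0 q1 A1).
have q3 := ler_wpM2l Mw (ler_pM A'0 dA0 A'1 dA1).
have q4 := ler_wpM2l Mw (ler_wpM2l d0 B1).
have q5 := ler_wpM2l Mw dB1.
have q6 := ler_wpM2l Mw2 dA1.
have q7 := ler_wpM2l Mw2 (ler_wpM2r d0 AA).
have p3 : 0 <= M ^+ 3 * w ^+ 3 * d by rewrite !mulr_ge0 ?exprn_ge0.
have p2 : 0 <= M ^+ 2 * w ^+ 3 * d by rewrite !mulr_ge0 ?exprn_ge0.
by lra.
Qed.

End DefectConstants.

Section LocalAlmostFlow.
Context {R : realType} {V : completeNormedModType R}.
Variables (W : R -> V -> V) (WW : R -> R -> sumprod V V -> V).

Definition step s t (x : V) := field_incr W s t x + WW s t (diag x).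
Definition rough_step s t (x : V) := x + step s t x.

Variables (xi : V) (al h M e : R).
Hypothesis HW : forall s t, 0 <= s -> s <= t -> t <= h ->
  Cn_bounded 3 (field_incr W s t) xi 2 (M * (t - s) `^ al).
Hypothesis HWW : forall s t, 0 <= s -> s <= t -> t <= h ->
  Cn_bounded 2 (WW s t) (diag xi) 4 (M * (t - s) `^ al ^+ 2).
Hypothesis chenW : forall s u t x, 0 <= s -> s <= u -> u <= t -> t <= h ->
  WW s t (diag x) - WW s u (diag x) - WW u t (diag x)
  = frechet (field_incr W u t) x (field_incr W s u x).
Hypotheses (al0 : 0 < al) (M0 : 0 <= M) (h1 : h `^ al <= 1)
  (hs : 8 * M * h `^ al <= 1) (he : 3 * M * h `^ al <= e).

Lemma powR_time s t : 0 <= s -> s <= t -> t <= h -> 0 <= (t - s) `^ al <= h `^ al.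
Proof.
move=> s0 st th; rewrite powR_ge0 powR_mono ?subr_ge0 ?(ltW al0)//.
by rewrite (le_trans _ th)// gerBl.
Qed.

Lemma field_incrxx t : field_incr W t t = fun _ => 0.
Proof. by apply/funext => x; rewrite /field_incr subrr. Qed.

Lemma step_id t x : 0 <= t -> t <= h -> step t t x = 0.
Proof.
move=> t0 th; rewrite /step field_incrxx add0r.
have := chenW x t0 (lexx t) (lexx t) th; rewrite subrr sub0r field_incrxx linear0.
by move/eqP; rewrite oppr_eq0 => /eqP.
Qed.

Lemma step_le s t x : 0 <= s -> s <= t -> t <= h -> `|x - xi| <= 2 ->
  `|step s t x| <= 2 * M * (t - s) `^ al.
Proof.
move=> s0 st th x2; have /andP[w0 w1] := powR_time s0 st th.
rewrite (le_trans (expansion_le (HW s0 st th) (HWW s0 st th) x2))//.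
have : (t - s) `^ al ^+ 2 <= (t - s) `^ al.
  by rewrite expr2 ler_piMl// (le_trans w1).
by move=> /(ler_wpM2l M0); lra.
Qed.

Lemma step_lip s t x y : 0 <= s -> s <= t -> t <= h -> `|x - xi| <= 2 ->
  `|y - xi| <= 2 ->
  `|step s t x - step s t y| <= 3 * M * (t - s) `^ al * `|x - y|.
Proof.
move=> s0 st th x2 y2; have /andP[w0 w1] := powR_time s0 st th.
rewrite (le_trans (expansion_lip (HW s0 st th) (HWW s0 st th) x2 y2))//.
have : (t - s) `^ al ^+ 2 <= (t - s) `^ al.
  by rewrite expr2 ler_piMl// (le_trans w1).
by move=> /(ler_wpM2l M0) c; rewrite ler_wpM2r//; lra.
Qed.

(** Chen's relation cancels the terms of order one and two: the term
    DW_{u,t}(x)(W_{s,u}(x)) which it produces in WW_{s,t}(x, x) is the linear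
    part of W_{u,t}(x + a) - W_{u,t}(x), up to DW_{u,t}(x) b. *)
Lemma rough_step_defect s u t x : 0 <= s -> s <= u -> u <= t -> t <= h ->
  defect rough_step s u t x =
  remainder (field_incr W u t) (WW u t) x (step s u x) (WW s u (diag x)).
Proof.
move=> s0 su ut th; have c := chenW x s0 su ut th.
rewrite /defect /remainder /taylor1 /rough_step.
set a := step s u x; set g := field_incr W u t in c *.
set w := field_incr W s u x in c; set b := WW s u (diag x) in c *.
have -> : frechet g x a = frechet g x w + frechet g x b by exact: linearD.
have -> : step u t (x + a) = g (x + a) + WW u t (diag (x + a)) by [].
have -> : step s t x = w + g x + (frechet g x w + b + WW u t (diag x)).
  rewrite /step; congr (_ + _); first by rewrite /w /g /field_incr; lin_module R.
  by rewrite -c; lin_module R.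
(* Naming x + a turns the goal into a linear identity modulo this one. *)
set y := x + a; have z : y - (x + (w + b)) = 0 by rewrite subrr.
by rewrite -[RHS]addr0 -z; clearbody y; lin_module R.
Qed.

Lemma powR3 s t : (t - s) `^ (3 * al) = ((t - s) `^ al) ^+ 3.
Proof. by rewrite mulrC powRrM powR_mulrn// powR_ge0. Qed.

Lemma powR_subinterval s u t : 0 <= s -> s <= u -> u <= t ->
  (u - s) `^ al <= (t - s) `^ al /\ (t - u) `^ al <= (t - s) `^ al.
Proof.
move=> s0 su ut; split; rewrite powR_mono ?subr_ge0 ?(ltW al0)//.
  by rewrite lerD2r.
by rewrite lerD2l lerN2.
Qed.

Lemma step_Cn_bounded s u t : 0 <= s -> s <= u -> u <= t -> t <= h ->
  Cn_bounded 3 (field_incr W u t) xi 2 (M * (t - s) `^ al) /\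
  Cn_bounded 2 (WW u t) (diag xi) 4 (M * (t - s) `^ al ^+ 2).
Proof.
move=> s0 su ut th; have u0 : 0 <= u by exact: le_trans su.
have [_ w] := powR_subinterval s0 su ut; split.
  apply: Cn_bounded_weaken (HW u0 ut th); exact: ler_wpM2l.
apply: Cn_bounded_weaken (HWW u0 ut th); apply: ler_wpM2l => //.
by rewrite lerXn2r ?nnegrE ?powR_ge0.
Qed.

Lemma step_bounds s u t x : 0 <= s -> s <= u -> u <= t -> t <= h ->
  `|x - xi| <= 2 -> `|step s u x| <= 2 * M * (t - s) `^ al /\
  `|WW s u (diag x)| <= M * (t - s) `^ al ^+ 2.
Proof.
move=> s0 su ut th x2; have uh : u <= h by exact: le_trans th.
have [w _] := powR_subinterval s0 su ut; split.
  by rewrite (le_trans (step_le s0 su uh x2))// ler_wpM2l// mulr_ge0.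
have x4 : `|diag x - diag xi| <= 4 by rewrite norm_diagB; lra.
rewrite (le_trans (Cn_bounded_le (HWW s0 su uh) x4))// ler_wpM2l//.
by rewrite lerXn2r ?nnegrE ?powR_ge0.
Qed.

Lemma step_lip_bounds s u t x y : 0 <= s -> s <= u -> u <= t -> t <= h ->
  `|x - xi| <= 2 -> `|y - xi| <= 2 ->
  `|step s u x - step s u y| <= 3 * M * (t - s) `^ al * `|x - y| /\
  `|WW s u (diag x) - WW s u (diag y)| <=
     2 * M * (t - s) `^ al ^+ 2 * `|x - y|.
Proof.
move=> s0 su ut th x2 y2; have uh : u <= h by exact: le_trans th.
have [w _] := powR_subinterval s0 su ut; split.
  by rewrite (le_trans (step_lip s0 su uh x2 y2))// ler_wpM2r// ler_wpM2l// mulr_ge0.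
have x4 : `|diag x - diag xi| <= 4 by rewrite norm_diagB; lra.
have y4 : `|diag y - diag xi| <= 4 by rewrite norm_diagB; lra.
rewrite (le_trans (Cn_bounded_lip (HWW s0 su uh) x4 y4))// norm_diagB mulrA ler_wpM2r//.
rewrite mulrC mulrA ler_wpM2l ?mulr_ge0//.
by rewrite lerXn2r ?nnegrE ?powR_ge0.
Qed.

Lemma step_ball2 s u x : 0 <= s -> s <= u -> u <= h -> `|x - xi| <= 1 ->
  `|x + step s u x - xi| <= 2.
Proof.
move=> s0 su uh x1; have x2 : `|x - xi| <= 2 by rewrite (le_trans x1)// ler1n.
have a := step_le s0 su uh x2; have /andP[w0 w1] := powR_time s0 su uh.
have b := ler_wpM2l M0 w1.
rewrite addrAC (le_trans (ler_normD _ _))//; move: hs; lra.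
Qed.

Lemma rough_step_almost_flow :
  almost_flow rough_step h (3 * al) xi e (5 * M) (30 * (M ^+ 3 + M ^+ 2)).
Proof.
have to2 (z : V) : `|z - xi| <= 1 -> `|z - xi| <= 2.
  by move=> /le_trans; apply; rewrite ler1n.
have sE s t (x : V) : rough_step s t x - x = step s t x.
  by rewrite /rough_step addrC addKr.
split.
- by move=> t x /andP[t0 th]; rewrite /rough_step step_id// addr0.
- move=> s t x s0 st th x1; rewrite sE (le_trans (step_le s0 st th (to2 _ x1)))//.
  have /andP[w0 w1] := powR_time s0 st th.
  by have := ler_wpM2l M0 w1; move: hs; lra.
- move=> s t x y s0 st th x2 y2; rewrite !sE (le_trans (step_lip s0 st th x2 y2))//.
  have /andP[w0 w1] := powR_time s0 st th.
  by rewrite ler_wpM2r//; have := ler_wpM2l M0 w1; move: he; lra.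
- move=> s t x y x' y' s0 st th x2 y2 x'2 y'2; rewrite !sE.
  have := expansion_four (HW s0 st th) (HWW s0 st th) x2 y2 x'2 y'2.
  move=> /le_trans; apply.
  have /andP[w0 w1] := powR_time s0 st th.
  have c : (t - s) `^ al ^+ 2 <= (t - s) `^ al.
    by rewrite expr2 ler_piMl// (le_trans w1).
  have {}c := ler_wpM2l M0 c.
  have d := ler_wpM2l M0 w1; have d' := ler_wpM2l M0 h1.
  rewrite lerD//; first by rewrite ler_wpM2r//; move: he; lra.
  by rewrite ler_wpM2r// ler_wpM2r ?addr_ge0//; lra.
- move=> s u t x s0 su ut th x1; rewrite rough_step_defect//.
  have [st uh u0] : [/\ s <= t, u <= h & 0 <= u].
    by split; [exact: le_trans ut|exact: le_trans th|exact: le_trans su].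
  have [gC GC] := step_Cn_bounded s0 su ut th.
  have x2 := to2 _ x1.
  have [A2 B2] := step_bounds s0 su ut th x2.
  have xa2 := step_ball2 s0 su uh x1.
  rewrite (le_trans (remainder_le gC GC _ x2 xa2))// powR3//.
  by apply: defect_num; rewrite ?powR_ge0.
- move=> s u t x y s0 su ut th x1 y1; rewrite !rough_step_defect//.
  have [st uh u0] : [/\ s <= t, u <= h & 0 <= u].
    by split; [exact: le_trans ut|exact: le_trans th|exact: le_trans su].
  have [gC GC] := step_Cn_bounded s0 su ut th.
  have x2 := to2 _ x1; have y2 := to2 _ y1.
  have [A2 B2] := step_bounds s0 su ut th x2.
  have [A2' B2'] := step_bounds s0 su ut th y2.
  have [dA dB] := step_lip_bounds s0 su ut th x2 y2.
  have xa2 := step_ball2 s0 su uh x1.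
  have ya2 := step_ball2 s0 su uh y1.
  rewrite (le_trans (remainder_lip gC GC _ _ x2 y2 xa2 ya2))// powR3//.
  by apply: defect_lip_num; rewrite ?powR_ge0.
Qed.

End LocalAlmostFlow.

(** * Existence of a path satisfying Davie's estimate *)

Section SmallTime.
Context {R : realType}.
Implicit Types (al th k : R).

Lemma powR_small_time al k : 0 < al -> 0 < k -> exists2 h0 : R, 0 < h0 &
  forall h, 0 <= h -> h <= h0 -> h `^ al <= k.
Proof.
move=> al0 k0; exists (k `^ al^-1); first by rewrite powR_gt0.
move=> h h0 hk; have -> : k = (k `^ al^-1) `^ al.
  by rewrite -powRrM mulVf ?gt_eqF// powRr1// ltW.
by rewrite powR_mono// ltW.
Qed.

Lemma powR_half_lt th : 1 < th -> 2^-1 `^ th < 2^-1 :> R.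
Proof.
move=> th1; have h0 : 0 < 2^-1 :> R by rewrite invr_gt0.
rewrite -[th](subrK 1) powRD ?gt_eqF ?implybT//.
rewrite powRr1 ?ltW// -[ltRHS]mul1r ltr_pM2r//.
have := @gt0_ltr_powR R (th - 1); rewrite subr_gt0 => /(_ th1).
by move=> /(_ 2^-1 1); rewrite !nnegrE powR1; apply; lra.
by rewrite subrK (lt_trans ltr01).
Qed.

(** The factor lost in the induction of [euler_diff] is 2 + 6 e instead of 2, and
    2 * 2^-th < 1 because th > 1. *)
Lemma contraction_constant th : 1 < th -> exists2 e : R, 0 < e <= 1 &
  (2 + 6 * e) * 2^-1 `^ th < 1.
Proof.
move=> th1; have H1 := powR_half_lt th1; have H0 : 0 <= 2^-1 `^ th :> R by exact: powR_ge0.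
set H := 2^-1 `^ th in H0 H1 *.
exists ((1 - 2 * H) / 12); first by apply/andP; split; lra.
have q : H * (1 - 2 * H) <= 1 * (1 - 2 * H) by rewrite ler_wpM2r; lra.
have -> : (2 + 6 * ((1 - 2 * H) / 12)) * H = 2 * H + (H * (1 - 2 * H)) / 2 by field.
lra.
Qed.

End SmallTime.

Section DavieSolution.
Context {R : realType} {V : completeNormedModType R}.
Variables (W : R -> V -> V) (WW : R -> R -> sumprod V V -> V).

(** Davie's notion of solution, with the ball that makes it local. *)
Definition davie_solution (h th D : R) (xi : V) (Y : R -> V) : Prop :=
  Y 0 = xi /\ forall s t, 0 <= s -> s <= t -> t <= h ->
    `|Y s - xi| <= 1 /\
    `|Y t - rough_step W WW s t (Y s)| <= D * (t - s) `^ th.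

Section Existence.
Variables (xi : V) (al T M : R).
Hypothesis HW : forall s t, 0 <= s -> s <= t -> t <= T ->
  Cn_bounded 3 (field_incr W s t) xi 2 (M * (t - s) `^ al).
Hypothesis HWW : forall s t, 0 <= s -> s <= t -> t <= T ->
  Cn_bounded 2 (WW s t) (diag xi) 4 (M * (t - s) `^ al ^+ 2).
Hypothesis chenW : forall s u t x, 0 <= s -> s <= u -> u <= t -> t <= T ->
  WW s t (diag x) - WW s u (diag x) - WW u t (diag x)
  = frechet (field_incr W u t) x (field_incr W s u x).
Hypotheses (al3 : 3^-1 < al) (M0 : 0 <= M).

(** The constants are chosen in this order: [e] from the exponent, then D and L
    as the fixed points of the two inductions (they depend on M but not on h),
    and last the length h, so that M h^al, D h^(3 al) and L h^(3 al) are small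
    compared with [e].  The clause on M = 0 serves the case of a rough path of
    norm 0. *)
Lemma local_davie_solution : exists D h0, [/\ 0 <= D, M = 0 -> D = 0, 0 < h0 &
  forall h, 0 < h -> h <= h0 -> h <= T ->
  exists Y, davie_solution h (3 * al) D xi Y].
Proof.
have al0 : 0 < al by move: al3; lra.
have th1 : 1 < 3 * al by move: al3; lra.
have [e /andP[e0 e1] rho1] := contraction_constant th1.
set H := 2^-1 `^ (3 * al) in rho1 *; set rho := (2 + 6 * e) * H in rho1.
have r0 : 0 < 1 - rho by rewrite subr_gt0.
pose C := 30 * (M ^+ 3 + M ^+ 2); pose K := 5 * M.
have C0 : 0 <= C by rewrite mulr_ge0// addr_ge0// exprn_ge0.
have K0 : 0 <= K by rewrite mulr_ge0.
pose D := 2 * C / (1 - rho); pose L := (4 * C + 4 * K * D) / (1 - rho).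
have D0 : 0 <= D by apply: divr_ge0; [exact: mulr_ge0|exact: ltW].
have L0 : 0 <= L.
  by apply: divr_ge0 (ltW r0); exact: addr_ge0 (mulr_ge0 _ C0) (mulr_ge0 (mulr_ge0 _ K0) D0).
have fixpoint c : (2 + 6 * e) * (H * (c / (1 - rho))) + c = c / (1 - rho).
  have -> : (2 + 6 * e) * (H * (c / (1 - rho))) + c
     = rho * (c / (1 - rho)) + c by rewrite /rho; ring.
  by move: r0; clearbody rho => r0'; field; rewrite gt_eqF.
(* S h^al <= e bounds each of the products 8 M h^al, 4 D h^al and L h^al. *)
pose S := 1 + 8 * M + 4 * D + L.
have S1 : 1 <= S by rewrite /S; move: M0; lra.
have [h0 h00 hP] := powR_small_time al0 (divr_gt0 e0 (lt_le_trans ltr01 S1)).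
exists D, h0; split=> //.
  by move=> m0; rewrite /D /C m0 !expr0n /= addr0 !mulr0 mul0r.
move=> h hgt0 hle hT; have {hP}hal := hP _ (ltW hgt0) hle.
set w := h `^ al in hal; have w0 : 0 <= w by exact: powR_ge0.
have Sw : S * w <= e by rewrite mulrC -ler_pdivlMr// (lt_le_trans ltr01).
have Mw : 0 <= M * w by rewrite mulr_ge0.
have Dw : 0 <= D * w by rewrite mulr_ge0.
have Lw : 0 <= L * w by rewrite mulr_ge0.
have SwE : S * w = w + 8 * (M * w) + 4 * (D * w) + L * w by rewrite /S; ring.
have w1 : w <= 1 by lra.
have w3 : h `^ (3 * al) <= w.
  rewrite mulrC powRrM powR_mulrn// -/w exprS ler_piMr//.
  by rewrite expr2 mulr_ile1.
have AF := @rough_step_almost_flow R V W WW xi al h M e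
  (fun s t s0 st th => HW s0 st (le_trans th hT))
  (fun s t s0 st th => HWW s0 st (le_trans th hT))
  (fun s u t x s0 su ut th => chenW x s0 su ut (le_trans th hT)) al0 M0 w1.
have {}AF : almost_flow (rough_step W WW) h (3 * al) xi e K C.
  by apply: AF; rewrite -/w; lra.
have cD : (2 + 6 * e) * (H * D) + 2 * C <= D by rewrite fixpoint.
have cL : (2 + 6 * e) * (H * L) + 4 * C + 4 * K * D <= L.
  by rewrite -addrA fixpoint.
have sD : D * h `^ (3 * al) <= 4^-1.
  by rewrite (le_trans (ler_wpM2l D0 w3))//; lra.
have sL : L * h `^ (3 * al) <= e.
  by rewrite (le_trans (ler_wpM2l L0 w3))//; lra.
exists (euler_limit (rough_step W WW) xi); split.
  apply/eqP; rewrite -subr_eq0 -normr_le0; apply/ler_addgt0Pr => r rgt0.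
  rewrite add0r.
  have [d d0 dP] := @euler_limitP _ _ _ _ _ _ _ _ _ _ _ th1 (ltW e0) e1 K0 C0 D0 L0
    AF cD cL sD sL 0 r (lexx 0) (ltW hgt0) rgt0.
  by have := dP [::]; rewrite /= => h'; apply/ltW/h' => //; split.
move=> s t s0 st tht.
exact: (@euler_limit_davie _ _ _ _ _ _ _ _ _ _ _ th1 (ltW e0) e1 K0 C0 D0 L0
    AF cD cL sD sL).
Qed.

End Existence.
End DavieSolution.

(** * Paths satisfying Davie's estimate are solutions *)

Section HolderNorm.
Context {R : realType} {V : normedModType R}.

Lemma holder2_norm_le (g h B : R) (P : R -> R -> V) :
  (forall s t, 0 <= s <= h -> 0 <= t <= h -> s != t ->
     `|P s t| <= B * `|t - s| `^ g) ->
  (holder2_norm g 0%R h P <= B%:E)%E.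
Proof.
move=> PB; apply: ge_ereal_sup => _ [s [t [sh th st ->]]].
rewrite lee_fin ler_pdivrMr; last first.
  by rewrite powR_gt0// normr_gt0 subr_eq0 eq_sym.
by apply: PB.
Qed.

Lemma holder2_norm_lty (g h B : R) (P : R -> R -> V) :
  (forall s t, 0 <= s <= h -> 0 <= t <= h -> s != t ->
     `|P s t| <= B * `|t - s| `^ g) ->
  (holder2_norm g 0%R h P < +oo)%E.
Proof. by move=> /holder2_norm_le /le_lt_trans; apply; rewrite ltry. Qed.

Lemma holder_norm_le (g h B : R) (Y : R -> V) :
  (forall s t, 0 <= s -> s < t -> t <= h -> `|Y t - Y s| <= B * (t - s) `^ g) ->
  (holder_norm g 0%R h Y <= B%:E)%E.
Proof.
move=> YB; apply: holder2_norm_le => s t /andP[s0 sh] /andP[t0 th].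
rewrite neq_lt /incr => /orP[st|ts].
  by rewrite [X in _ * X `^ _]ger0_norm ?subr_ge0 ?(ltW st)//; exact: YB.
rewrite [X in _ * X `^ _]distrC [X in _ * X `^ _]ger0_norm ?subr_ge0 ?(ltW ts)//.
by rewrite distrC; exact: YB.
Qed.

End HolderNorm.

Section SolutionOfDavie.
Context {R : realType} {V : completeNormedModType R}.
Variables (W : R -> V -> V) (WW : R -> R -> sumprod V V -> V).
Variables (xi : V) (al h M D : R) (Y : R -> V).
Hypothesis HW : forall s t, 0 <= s -> s <= t -> t <= h ->
  Cn_bounded 3 (field_incr W s t) xi 2 (M * (t - s) `^ al).
Hypothesis HWW : forall s t, 0 <= s -> s <= t -> t <= h ->
  Cn_bounded 2 (WW s t) (diag xi) 4 (M * (t - s) `^ al ^+ 2).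
Hypotheses (al3 : 3^-1 < al) (M0 : 0 <= M) (D0 : 0 <= D).
Hypothesis (h1 : h `^ al <= 1).
Hypothesis DY : davie_solution W WW h (3 * al) D xi Y.

Let al0 : 0 < al. Proof. by move: al3; lra. Qed.

Fixpoint local_sum s p : V :=
  if p is u :: p' then step W WW s u (Y s) + local_sum u p' else 0.

Lemma rough_sumE t p : rough_sum W WW Y Y 0 t p = local_sum 0 p.
Proof.
rewrite /rough_sum; elim: p (0 : R) => [|u p IH] s /=; first by rewrite big_geq.
by rewrite big_nat_recl//=; congr (_ + _); exact: IH.
Qed.

(** Telescoping of Davie's estimate over the steps of the partition. *)
Lemma local_sum_close s p : 0 <= s -> path <%R s p -> last s p <= h ->
  `|(Y (last s p) - Y s) - local_sum s p| <= D * powsum (3 * al) s p.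
Proof.
elim: p s => [|u p IH] s s0 /=; first by rewrite !subrr normr0 mulr0.
move=> /andP[su up] lh; have u0 : 0 <= u by rewrite (le_trans s0)// ltW.
have uh : u <= h by rewrite (le_trans (path_lt_last up)).
have -> : Y (last u p) - Y s - (step W WW s u (Y s) + local_sum u p) =
   (Y u - rough_step W WW s u (Y s)) + (Y (last u p) - Y u - local_sum u p).
  by rewrite /rough_step; lin_module R.
rewrite (le_trans (ler_normD _ _))// mulrDr lerD//; last exact: IH.
by have [_] := DY.2 s u s0 (ltW su) uh.
Qed.

Lemma rough_sum_cvg t : 0 <= t -> t <= h ->
  rough_sum W WW Y Y 0 t @ partition_mesh 0 t --> Y t - xi.
Proof.
move=> t0 th; have PF := partition_mesh_filter t0.
apply/cvgrPdist_lt => ep ep0; apply/partition_meshP.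
have Dt : 0 <= D * t by rewrite mulr_ge0.
have th1 : 1 < 3 * al by move: al3; lra.
have [d d0 dP] := powR_mesh_small th1 Dt ep0.
exists d => // p [pp /eqP pl] pd; rewrite rough_sumE -DY.1.
apply: le_lt_trans dP.
have := local_sum_close (lexx 0) pp; rewrite pl => /(_ th) /le_trans; apply.
have := powsum_le th1 pp pd; rewrite pl subr0 => /(ler_wpM2l D0) /le_trans; apply.
by rewrite mulrCA.
Qed.

Lemma davie_expansion s t : 0 <= s -> s <= t -> t <= h ->
  `|Y t - Y s - field_incr W s t (Y s)| <= (M + D) * (t - s) `^ al ^+ 2.
Proof.
move=> s0 st th; have [s1 d] := DY.2 s t s0 st th.
have s4 : `|diag (Y s) - diag xi| <= 4 by rewrite norm_diagB; lra.
have b := Cn_bounded_le (HWW s0 st th) s4.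
have -> : Y t - Y s - field_incr W s t (Y s) =
   (Y t - rough_step W WW s t (Y s)) + WW s t (diag (Y s)).
  by rewrite /rough_step /step; lin_module R.
rewrite (le_trans (ler_normD _ _))// mulrDl addrC lerD//.
rewrite (le_trans d)// ler_wpM2l// powR3 exprSr ler_piMr// ?exprn_ge0 ?powR_ge0//.
by rewrite (le_trans _ h1)//; have /andP[] := powR_time al0 s0 st th.
Qed.

Lemma davie_increment s t : 0 <= s -> s <= t -> t <= h ->
  `|Y t - Y s| <= (2 * M + D) * (t - s) `^ al.
Proof.
move=> s0 st th; have [s1 d] := DY.2 s t s0 st th.
have s2 : `|Y s - xi| <= 2 by rewrite (le_trans s1)// ler1n.
have a := davie_expansion s0 st th.
have b := Cn_bounded_le (HW s0 st th) s2.
rewrite -(subrK (field_incr W s t (Y s)) (Y t - Y s)).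
rewrite (le_trans (ler_normD _ _))// (le_trans (lerD a b))//.
have /andP[w0 w1] := powR_time al0 s0 st th.
have : (t - s) `^ al ^+ 2 <= (t - s) `^ al.
  by rewrite expr2 ler_piMl// (le_trans w1).
by move=> /(ler_wpM2l (addr_ge0 M0 D0)); lra.
Qed.

(** For t < s the remainder at (s, t) is read off from the one at (t, s), up to
    W_{t,s}(Y_s) - W_{t,s}(Y_t), which is of order |t - s|^(2 al). *)
Lemma davie_controlled : controlled h al W Y Y.
Proof.
have HY : (holder_norm al 0%R h Y < +oo)%E.
  apply: le_lt_trans (ltry (2 * M + D)); apply: holder_norm_le => s t s0 st th.
  exact: davie_increment s0 (ltW st) th.
split=> //.
apply: (@holder2_norm_lty _ _ _ _ ((M + D) + M * (2 * M + D))).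
move=> s t /andP[s0 sh] /andP[t0 th]; rewrite neq_lt /incr => /orP[st|ts].
  rewrite [X in _ * X `^ _]ger0_norm ?subr_ge0 ?(ltW st)//.
  rewrite (le_trans (davie_expansion s0 (ltW st) th))//.
  rewrite [2 * al]mulrC powRrM powR_mulrn ?powR_ge0// ler_wpM2r ?exprn_ge0 ?powR_ge0//.
  by rewrite lerDl mulr_ge0 ?addr_ge0 ?mulr_ge0.
rewrite [X in _ * X `^ _]distrC [X in _ * X `^ _]ger0_norm ?subr_ge0 ?(ltW ts)//.
have e1 := davie_expansion t0 (ltW ts) sh.
have e2 := davie_increment t0 (ltW ts) sh.
have [t1 _] := DY.2 t s t0 (ltW ts) sh.
have [s1 _] := DY.2 s s s0 (lexx s) sh.
have t2 : `|Y t - xi| <= 2 by rewrite (le_trans t1)// ler1n.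
have s2 : `|Y s - xi| <= 2 by rewrite (le_trans s1)// ler1n.
have e3 := Cn_bounded_lip (HW t0 (ltW ts) sh) s2 t2.
have -> : Y t - Y s - field_incr W s t (Y s) =
  - (Y s - Y t - field_incr W t s (Y t))
  + (field_incr W t s (Y s) - field_incr W t s (Y t)).
  by rewrite /field_incr; lin_module R.
rewrite (le_trans (ler_normD _ _))// normrN.
rewrite [2 * al]mulrC powRrM powR_mulrn ?powR_ge0// mulrDl lerD//.
rewrite (le_trans e3)//.
rewrite (le_trans (ler_wpM2l (mulr_ge0 M0 (powR_ge0 _ _)) e2))//.
by rewrite le_eqVlt; apply/orP; left; apply/eqP; ring.
Qed.

Lemma davie_rde_solution : rde_solution al h W WW xi Y.
Proof.
have C := davie_controlled; split=> //; [by case: C|exact: DY.1|].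
move=> t; rewrite in_itv /= => /andP[t0 th].
have PF := partition_mesh_filter t0; have c := rough_sum_cvg t0 th.
split; first by apply/cvg_ex; exists (Y t - xi).
by rewrite /rough_integral (cvg_lim _ c)// addrC subrK.
Qed.

End SolutionOfDavie.

(** * From weighted norms to bounds on a ball *)

Section WeightedNorms.
Context {R : realType} {V : normedModType R}.

(** Suprema of nonempty sets of nonnegative reals are nonnegative, so that none of
    them can make the sum smaller, as -oo would do. *)
Lemma sum_ereal_sup_ub n (S : nat -> set (\bar R)) :
  (forall k, (k < n)%N -> exists2 r : R, 0 <= r & S k r%:E) ->
  (0 <= \sum_(0 <= k < n) ereal_sup (S k))%E /\
  forall k x, (k < n)%N -> S k x ->
    (x <= \sum_(0 <= k < n) ereal_sup (S k))%E.
Proof.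
move=> S0.
have sup0 k : (k < n)%N -> (0 <= ereal_sup (S k))%E.
  move=> /S0[r r0 Sr]; apply: (@le_trans _ _ r%:E); first by rewrite lee_fin.
  exact: ereal_sup_ubound.
split; first by rewrite big_mkord; apply: sume_ge0 => i _; exact: sup0.
move=> k x kn Sx; rewrite big_mkord (bigD1 (Ordinal kn))//=.
apply: (le_trans (ereal_sup_ubound Sx)); rewrite leeDl//.
by apply: sume_ge0 => i _; exact: sup0.
Qed.

Lemma field_norm_ub (T a : R) n b (F : R -> V -> V) : 0 < T ->
  (0 <= field_norm T a n b F)%E /\
  forall k s t x, (k <= n)%N -> 0 <= s <= T -> 0 <= t <= T -> s != t ->
  ((`|iter_frechet k (field_incr F s t) x|
    / (`|t - s| `^ a * (1 + `|x|) `^ b k))%:E <= field_norm T a n b F)%E.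
Proof.
move=> T0; have [|p1 p2] := @sum_ereal_sup_ub n.+1
  (fun k => [set r | exists s t x, [/\ s \in `[0%R, T], t \in `[0%R, T], s != t
      & r = (`|iter_frechet k (field_incr F s t) x|
             / (`|t - s| `^ a * (1 + `|x|) `^ b k))%:E]]).
  move=> k kn; exists (`|iter_frechet k (field_incr F 0 T) 0|
     / (`|T - 0| `^ a * (1 + `|0 : V|) `^ b k)).
    by rewrite divr_ge0 ?mulr_ge0 ?powR_ge0.
  by exists 0, T, 0; split; rewrite ?in_itv /= ?lexx ?(ltW T0) ?lt_eqF.
split=> // k s t x kn sT tT st; apply: (p2 k) => //.
by exists s, t, x; rewrite !in_itv.
Qed.

Lemma field2_norm_ub (T a : R) n b1 b2 (P : R -> R -> sumprod V V -> V) : 0 < T ->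
  (0 <= field2_norm T a n b1 b2 P)%E /\
  forall k s t (x : sumprod V V), (k <= n)%N ->
  0 <= s <= T -> 0 <= t <= T -> s != t ->
  ((`|iter_frechet k (P s t) x| / (`|t - s| `^ a * (1 + `|x.1|) `^ b1 k
                * (1 + `|x.2|) `^ b2 k))%:E <= field2_norm T a n b1 b2 P)%E.
Proof.
move=> T0; have [|p1 p2] := @sum_ereal_sup_ub n.+1
  (fun k => [set r | exists s t (x : sumprod V V),
      [/\ s \in `[0%R, T], t \in `[0%R, T], s != t
      & r = (`|iter_frechet k (P s t) x|
             / (`|t - s| `^ a * (1 + `|x.1|) `^ b1 k
                * (1 + `|x.2|) `^ b2 k))%:E]]).
  move=> k kn; exists (`|iter_frechet k (P 0 T) 0|
     / (`|T - 0| `^ a * (1 + `|(0 : sumprod V V).1|) `^ b1 k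
        * (1 + `|(0 : sumprod V V).2|) `^ b2 k)).
    by rewrite divr_ge0 ?mulr_ge0 ?powR_ge0.
  by exists 0, T, 0; split; rewrite ?in_itv /= ?lexx ?(ltW T0) ?lt_eqF.
split=> // k s t x kn sT tT st; apply: (p2 k) => //.
by exists s, t, x; rewrite !in_itv.
Qed.

Lemma bstar_ge0 (b : nat -> R) k : 0 <= b 0%N -> 0 <= bstar b k.
Proof. by move=> b0; rewrite (le_trans b0)// bigmax_ge_id. Qed.

Lemma bstarstar_ge0 (b : nat -> R) k : 0 <= b 1%N -> 0 <= bstarstar b k.
Proof. by move=> b0; rewrite (le_trans b0)// bigmax_ge_id. Qed.

End WeightedNorms.

Section LocalBounds.
Context {R : realType} {V : completeNormedModType R}.
Variables (T alpha : R) (beta : nat -> R) (W : R -> V -> V)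
  (WW : R -> R -> sumprod V V -> V) (xi : V).
Hypotheses (T0 : 0 < T)
  (beta0 : forall k, (k <= 3)%N -> 0 <= beta k)
  (rpW : nonlinear_rough_path T alpha 3 beta W WW).

Definition rough_normr : R := fine (rough_norm T alpha 3 beta W WW).

Lemma rough_normr_spec : exists n1 n2 : R, [/\ 0 <= n1, 0 <= n2,
  field_norm T alpha 3 beta W = n1%:E,
  field2_norm T (2 * alpha) 2 (bstar beta) (bstarstar beta) WW = n2%:E
  & rough_normr = n1 + n2].
Proof.
have [[_ f1] [_ f2] _] := rpW.
have [g1 _] := field_norm_ub alpha 3 beta W T0.
have [g2 _] := field2_norm_ub (2 * alpha) 2 (bstar beta) (bstarstar beta) WW T0.
rewrite /rough_normr /rough_norm; rewrite /= in f2 *.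
move: f1 f2 g1 g2; case: (field_norm _ _ _ _ _) => // n1 _.
case: (field2_norm _ _ _ _ _ _) => // n2 _; rewrite !lee_fin => n10 n20.
by exists n1, n2.
Qed.

Lemma rough_normr_ge0 : 0 <= rough_normr.
Proof. by have [n1 [n2 [n10 n20 _ _ ->]]] := rough_normr_spec; exact: addr_ge0. Qed.

Lemma field_incr_bound k s t x : (k <= 3)%N -> 0 <= s -> s < t -> t <= T ->
  `|iter_frechet k (field_incr W s t) x|
    <= rough_normr * (t - s) `^ alpha * (1 + `|x|) `^ beta k.
Proof.
move=> k3 s0 st tT; have [n1 [n2 [n10 n20 E1 _ ->]]] := rough_normr_spec.
have [_ /(_ k s t x k3)] := field_norm_ub alpha 3 beta W T0.
have sT : 0 <= s <= T by rewrite s0 (le_trans (ltW st)).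
have tT' : 0 <= t <= T by rewrite tT (le_trans s0)// ltW.
move=> /(_ sT tT'); rewrite lt_eqF// => /(_ isT); rewrite E1 lee_fin.
have p1 : 0 < (t - s) `^ alpha by rewrite powR_gt0 ?subr_gt0.
have p2 : 0 < (1 + `|x|) `^ beta k by rewrite powR_gt0// ltr_pwDl.
rewrite ger0_norm ?subr_ge0 ?(ltW st)// ler_pdivrMr ?mulr_gt0// mulrA.
move=> /le_trans; apply; rewrite ler_wpM2r ?(ltW p2)// ler_wpM2r ?(ltW p1)//.
by rewrite lerDl.
Qed.

Lemma second_order_bound k s t (x : sumprod V V) : (k <= 2)%N ->
  0 <= s -> s < t -> t <= T ->
  `|iter_frechet k (WW s t) x| <= rough_normr * (t - s) `^ alpha ^+ 2 *
     ((1 + `|x.1|) `^ bstar beta k * (1 + `|x.2|) `^ bstarstar beta k).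
Proof.
move=> k2 s0 st tT; have [n1 [n2 [n10 n20 _ E2 ->]]] := rough_normr_spec.
have [_ /(_ k s t x k2)] :=
  field2_norm_ub (2 * alpha) 2 (bstar beta) (bstarstar beta) WW T0.
have sT : 0 <= s <= T by rewrite s0 (le_trans (ltW st)).
have tT' : 0 <= t <= T by rewrite tT (le_trans s0)// ltW.
move=> /(_ sT tT'); rewrite lt_eqF// => /(_ isT); rewrite E2 lee_fin.
have p1 : 0 < (t - s) `^ alpha by rewrite powR_gt0 ?subr_gt0.
have p2 : 0 < (1 + `|x.1|) `^ bstar beta k by rewrite powR_gt0// ltr_pwDl.
have p3 : 0 < (1 + `|x.2|) `^ bstarstar beta k by rewrite powR_gt0// ltr_pwDl.
rewrite ger0_norm ?subr_ge0 ?(ltW st)//.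
rewrite [2 * alpha]mulrC powRrM powR_mulrn ?powR_ge0//.
rewrite ler_pdivrMr ?mulr_gt0 ?exprn_gt0//.
move=> /le_trans; apply; rewrite !mulrA.
by rewrite !ler_wpM2r ?(ltW p2) ?(ltW p3) ?exprn_ge0 ?(ltW p1)// lerDr.
Qed.

Definition weight_base : R := 5 + `|xi|.
(** A common upper bound for all the weights on the ball of radius 4 around xi;
    the sum is used as a substitute for the maximum. *)
Definition weight : R := \sum_(k < 4) weight_base `^ beta k
  + \sum_(k < 3) weight_base `^ bstar beta k * weight_base `^ bstarstar beta k.

Lemma weight_ub : [/\ 0 <= weight,
  forall k, (k <= 3)%N -> weight_base `^ beta k <= weight &
  forall k, (k <= 2)%N ->
    weight_base `^ bstar beta k * weight_base `^ bstarstar beta k <= weight].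
Proof.
have s1 : 0 <= \sum_(k < 4) weight_base `^ beta k.
  by apply: sumr_ge0 => i _; exact: powR_ge0.
have s2 : 0 <= \sum_(k < 3) weight_base `^ bstar beta k * weight_base `^ bstarstar beta k.
  by apply: sumr_ge0 => i _; rewrite mulr_ge0 ?powR_ge0.
split; first exact: addr_ge0.
  move=> k k3; rewrite /weight -[leLHS]addr0 lerD//.
  rewrite -ltnS in k3; rewrite (bigD1 (Ordinal k3))//= lerDl.
  by apply: sumr_ge0 => i _; exact: powR_ge0.
move=> k k2; rewrite /weight -[leLHS]add0r lerD//.
rewrite -ltnS in k2; rewrite (bigD1 (Ordinal k2))//= lerDl.
by apply: sumr_ge0 => i _; rewrite mulr_ge0 ?powR_ge0.
Qed.

Definition local_bound : R := rough_normr * weight.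

Lemma local_bound_ge0 : 0 <= local_bound.
Proof. by have [w0 _ _] := weight_ub; rewrite mulr_ge0 ?rough_normr_ge0. Qed.

Lemma norm_le_weight_base (x : V) : `|x - xi| <= 4 -> 1 + `|x| <= weight_base.
Proof.
move=> x4; have := ler_normD (x - xi) xi; rewrite subrK /weight_base; lra.
Qed.

Lemma field_incr_differentiable s t k x : (k < 3)%N -> 0 <= s <= T -> 0 <= t <= T ->
  differentiable (iter_frechet k (field_incr W s t)) x.
Proof.
move=> k3 sT tT; have [[cW _] _ _] := rpW.
have [|ds _] := cW s; first by rewrite in_itv.
have [|dt _] := cW t; first by rewrite in_itv.
rewrite (iter_frechetB dt ds (ltnW k3)).
by apply: differentiableB; [exact: dt|exact: ds].
Qed.

Lemma field_incr_Cn_bounded s t : 0 <= s -> s <= t -> t <= T ->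
  Cn_bounded 3 (field_incr W s t) xi 2 (local_bound * (t - s) `^ alpha).
Proof.
move=> s0; rewrite le_eqVlt => /orP[/eqP<- tT|st tT].
  by rewrite field_incrxx; apply: Cn_bounded0; rewrite mulr_ge0 ?local_bound_ge0 ?powR_ge0.
have [w0 w1 _] := weight_ub; split=> k k3 x.
  by apply: field_incr_differentiable => //; apply/andP; split=> //; lra.
move=> x2; rewrite (le_trans (field_incr_bound _ k3 s0 st tT))//.
rewrite /local_bound [leRHS]mulrAC ler_wpM2l ?mulr_ge0 ?rough_normr_ge0 ?powR_ge0//.
rewrite (le_trans _ (w1 k k3))// powR_mono ?beta0 ?addr_ge0//.
by rewrite norm_le_weight_base// (le_trans x2)// ler_nat.
Qed.

Lemma chen_diag s u t x : 0 <= s -> s <= u -> u <= t -> t <= T ->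
  WW s t (diag x) - WW s u (diag x) - WW u t (diag x)
  = frechet (field_incr W u t) x (field_incr W s u x).
Proof.
move=> s0 su ut tT; have [_ _ cW] := rpW.
have uT : 0 <= u <= T by apply/andP; split; lra.
have tT' : 0 <= t <= T by apply/andP; split; lra.
rewrite frechetE; last exact: (@field_incr_differentiable u t 0%N x isT uT tT').
by apply: cW; rewrite in_itv /=; apply/andP; split; lra.
Qed.

(** Chen's relation at s = u = t. *)
Lemma second_orderxx t : 0 <= t <= T -> WW t t = fun=> 0.
Proof.
move=> tT; apply/funext => -[x y]; have [_ _ cW] := rpW.
have ti : t \in `[0, T] by rewrite in_itv.
have := cW x y t t t ti ti ti; rewrite field_incrxx linear0 subrr sub0r.
by move/eqP; rewrite oppr_eq0 => /eqP.
Qed.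

Lemma second_order_Cn_bounded s t : 0 <= s -> s <= t -> t <= T ->
  Cn_bounded 2 (WW s t) (diag xi) 4 (local_bound * (t - s) `^ alpha ^+ 2).
Proof.
move=> s0; rewrite le_eqVlt => /orP[/eqP<- tT|st tT].
  rewrite second_orderxx ?s0//; apply: Cn_bounded0.
  by rewrite mulr_ge0 ?local_bound_ge0 ?exprn_ge0 ?powR_ge0.
have [w0 _ w2] := weight_ub; have [_ [cWW _] _] := rpW.
have [|//|dWW _] := cWW s t; rewrite ?in_itv /=; [by apply/andP; split; lra|
  by apply/andP; split; lra|].
split=> [//|k k2 x x4].
rewrite (le_trans (second_order_bound _ k2 s0 st tT))//.
rewrite /local_bound [leRHS]mulrAC ler_wpM2l ?mulr_ge0 ?rough_normr_ge0 ?exprn_ge0 ?powR_ge0//.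
have xE : `|x - diag xi| = `|x.1 - xi| + `|x.2 - xi| by [].
have x1 : 1 + `|x.1| <= weight_base.
  by apply: norm_le_weight_base; rewrite (le_trans _ x4)// xE lerDl.
have x2 : 1 + `|x.2| <= weight_base.
  by apply: norm_le_weight_base; rewrite (le_trans _ x4)// xE lerDr.
rewrite (le_trans _ (w2 k k2))// ler_pM ?powR_ge0// powR_mono ?addr_ge0//.
  by apply: bstar_ge0; exact: beta0.
by apply: bstarstar_ge0; exact: beta0.
Qed.

End LocalBounds.

(** * The constants of the Hoelder estimate *)

Section HolderConstants.
Context {R : realType}.
Variables (gam b N x y eta : R).
Hypotheses (gam0 : 0 < gam) (b0 : 0 <= b) (bgam : b <= gam) (N0 : 0 <= N)
  (x0 : 0 <= x) (y0 : 0 <= y) (yx : y <= x + (6 * gam)^-1).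

Let r0 : 0 < (6 * gam)^-1. Proof. by rewrite invr_gt0 mulr_gt0. Qed.

(** The margin of the two constants: 1 + y is at most (1 + x) times
    1 + (6 gam)^-1 when y exceeds x by no more than (6 gam)^-1. *)
Lemma powR_shift : (1 + y) `^ b <= (1 + (6 * gam)^-1) `^ b * (1 + x) `^ b.
Proof.
rewrite -powRM ?addr_ge0 ?(ltW r0)// powR_mono ?addr_ge0//.
have := mulr_ge0 (ltW r0) x0; move: yx; lra.
Qed.

Lemma one_le_powR (z c : R) : 1 <= z -> 0 <= c -> 1 <= z `^ c.
Proof. by move=> z1 c0; rewrite -[leLHS](congr1 (fun f => f c) (powR1 R)) powR_mono. Qed.

Lemma first_holder_bound : eta <= 1 ->
  N * (1 + y) `^ b + eta <=
  (1 + (6 * gam)^-1) `^ (1 + b) * (1 + N) * (1 + x) `^ b.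
Proof.
move=> e1; have a := ler_wpM2l N0 powR_shift.
rewrite powRD; last by rewrite gt_eqF// ltr_pwDl.
rewrite powRr1; last by rewrite addr_ge0// ltW.
set P := (1 + (6 * gam)^-1) `^ b in a *; set Z := (1 + x) `^ b in a *.
have P1 : 1 <= P by rewrite one_le_powR// lerDl ltW.
have Z1 : 1 <= Z by rewrite one_le_powR// lerDl.
have PZ : 1 <= P * Z by rewrite mulr_ege1.
have q : 0 <= (6 * gam)^-1 * (P * Z * (1 + N)).
  exact: mulr_ge0 (ltW r0) (mulr_ge0 (le_trans ler01 PZ) (addr_ge0 ler01 N0)).
lra.
Qed.

Lemma k_alpha_ge1 (al : R) : 3^-1 < al -> 1 <= (1 - 2 `^ (1 - 3 * al))^-1.
Proof.
move=> al3; have q0 : 0 < 2 `^ (1 - 3 * al) :> R by rewrite powR_gt0.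
have q1 : 2 `^ (1 - 3 * al) < 1 :> R.
  have -> : 1 - 3 * al = - (3 * al - 1) by ring.
  rewrite powRN invf_lt1 ?powR_gt0//.
  have := @gt0_ltr_powR R (3 * al - 1); rewrite subr_gt0.
  have -> : 1 < 3 * al by lra.
  by move=> /(_ isT 1 2); rewrite !nnegrE powR1; apply; rewrite ?ler01 ?ler0n ?ltr1n.
rewrite invf_ge1; lra.
Qed.

Lemma second_holder_bound (al : R) : 3^-1 < al -> eta <= N ->
  N * (1 + y) `^ b + eta <=
  2 * (1 - 2 `^ (1 - 3 * al))^-1 * ((1 + gam) / gam) `^ (1 + gam) * N
    * (1 + 2 * x) `^ gam.
Proof.
move=> al3 eN; have a := ler_wpM2l N0 powR_shift.
have k1 := k_alpha_ge1 al3; set k := (1 - _)^-1 in k1 *.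
have PX : (1 + (6 * gam)^-1) `^ b <= ((1 + gam) / gam) `^ (1 + gam).
  have c1 : 1 + (6 * gam)^-1 <= (1 + gam) / gam.
    have -> : (1 + gam) / gam = 1 + gam^-1 by field; rewrite gt_eqF.
    rewrite lerD2l.
    by rewrite lef_pV2 ?posrE ?mulr_gt0// ler_peMl ?(ltW gam0)// ler1n.
  apply: (@le_trans _ _ (((1 + gam) / gam) `^ b)).
    by rewrite powR_mono// addr_ge0// ltW.
  rewrite ler_powR//.
    by rewrite (le_trans _ c1)// lerDl ltW.
  by rewrite (le_trans bgam)// lerDr.
have ZZ : (1 + x) `^ b <= (1 + 2 * x) `^ gam.
  apply: (@le_trans _ _ ((1 + 2 * x) `^ b)).
    by rewrite powR_mono ?addr_ge0//; move: x0; lra.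
  by rewrite ler_powR// lerDl mulr_ge0.
have P1 : 1 <= (1 + (6 * gam)^-1) `^ b by rewrite one_le_powR// lerDl ltW.
have Z1 : 1 <= (1 + x) `^ b by rewrite one_le_powR// lerDl.
set P := (1 + (6 * gam)^-1) `^ b in a PX P1; set Z := (1 + x) `^ b in a ZZ Z1.
set X := _ `^ (1 + gam) in PX *; set U := _ `^ gam in ZZ *.
have XU : P * Z <= X * U by rewrite ler_pM// (le_trans ler01).
have PZ1 : 1 <= P * Z by rewrite mulr_ege1.
have XU1 : 1 <= X * U by rewrite (le_trans PZ1).
have q1 := ler_wpM2l N0 XU.
have q2 := ler_wpM2l N0 XU1.
have NXU : 0 <= N * (X * U) by rewrite mulr_ge0// (le_trans ler01).
have q3 := ler_wpM2r NXU k1.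
have -> : 2 * k * X * N * U = 2 * (k * (N * (X * U))) by ring.
lra.
Qed.

End HolderConstants.

Theorem theorem4p2 (R : realType) (V : completeNormedModType R)
    (sepV : separable_space V)
    (T alpha : R) (T_gt0 : 0 < T) (alpha_gt : 3^-1 < alpha)
    (alpha_le : alpha <= 2^-1)
    (beta : nat -> R) (beta_ge0 : forall k, (k <= 3)%N -> 0 <= beta k)
    (W : R -> V -> V) (WW : R -> R -> sumprod V V -> V)
    (rpW : nonlinear_rough_path T alpha 3 beta W WW) (xi : V) :
  exists h : R, 0 < h <= T /\ exists Y : R -> V,
    rde_solution alpha h W WW xi Y /\
    let gamma1 := Num.max (beta 0%N) (beta 1%N) + Num.max (beta 1%N) (beta 2%N) in
    let k_alpha := (1 - 2 `^ (1 - 3 * alpha))^-1 in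
    let normW := fine (rough_norm T alpha 3 beta W WW) in
    (gamma1 != 0 ->
     (holder_norm alpha 0%R h Y <=
       (Num.min
         ((1 + (6 * gamma1)^-1) `^ (1 + beta 0%N) * (1 + normW)
            * (1 + `|xi|) `^ beta 0%N)
         (2 * k_alpha * ((1 + gamma1) / gamma1) `^ (1 + gamma1) * normW
            * (1 + 2 * `|xi|) `^ gamma1))%:E)%E).
Proof.
have al0 : 0 < alpha by lra.
set gam := Num.max _ _ + Num.max _ _; set N := fine _.
have NE : N = rough_normr T alpha beta W WW by [].
have N0 : 0 <= N by rewrite NE; exact: (rough_normr_ge0 T_gt0 rpW).
have b0 : 0 <= beta 0%N by exact: beta_ge0.
have bgam : beta 0%N <= gam.
  by rewrite -[leLHS]addr0 lerD// le_max ?lexx// beta_ge0.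
set M := local_bound T alpha beta W WW xi.
have M0 : 0 <= M := local_bound_ge0 xi T_gt0 rpW.
have HW := field_incr_Cn_bounded xi T_gt0 beta_ge0 rpW.
have HWW := second_order_Cn_bounded xi T_gt0 beta_ge0 rpW.
have chenW := chen_diag rpW.
rewrite -/M in HW HWW.
have [D [h1 [D0 MD h10 sol]]] := local_davie_solution HW HWW chenW alpha_gt M0.
(* h is taken so small that Y moves by at most (6 gam)^-1 and that the second
   order part of its increments is at most min(1, N) |t - s|^alpha. *)
pose kap := if (gam != 0) && (N != 0)
  then Num.min 1 (Num.min (6 * gam)^-1 N) else 1.
have kap0 : 0 < kap.
  rewrite /kap; case: ifP => // /andP[g0 n0].
  have gp : 0 < gam by rewrite lt_neqAle eq_sym g0 (le_trans b0).
  have np : 0 < N by rewrite lt_neqAle eq_sym n0.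
  by rewrite !lt_min ltr01 invr_gt0 mulr_gt0.
have kap1 : kap <= 1 by rewrite /kap; case: ifP => // _; rewrite ge_min lexx.
pose S := 1 + 2 * M + D.
have S1 : 1 <= S by rewrite /S; lra.
have [h2 h20 small] := powR_small_time al0 (divr_gt0 kap0 (lt_le_trans ltr01 S1)).
pose h := Num.min T (Num.min h1 h2).
have hgt0 : 0 < h by rewrite !lt_min T_gt0 h10.
have hT : h <= T by rewrite ge_min lexx.
have hh1 : h <= h1 by rewrite !ge_min lexx orbT.
have hh2 : h <= h2 by rewrite !ge_min lexx !orbT.
have Sh : S * h `^ alpha <= kap.
  by rewrite mulrC -ler_pdivlMr ?small ?(ltW hgt0)// (lt_le_trans ltr01).
have [Y DY] := sol h hgt0 hh1 hT.
have {}HW s t s0 st th := HW s t s0 st (le_trans th hT).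
have {}HWW s t s0 st th := HWW s t s0 st (le_trans th hT).
have w0 : 0 <= h `^ alpha by exact: powR_ge0.
have w1 : h `^ alpha <= 1.
  by rewrite (le_trans _ kap1)// (le_trans _ Sh)// ler_peMl.
exists h; split; first by rewrite hgt0.
exists Y; split.
  exact: davie_rde_solution HW HWW alpha_gt M0 D0 w1 DY.
move=> /= g0; have gam0 : 0 < gam by rewrite lt_neqAle eq_sym g0 (le_trans b0).
apply: holder_norm_le => s t s0 st th.
have p0 : 0 <= (t - s) `^ alpha by exact: powR_ge0.
(* When N = 0 the second bound is 0, and Y is constant since M = D = 0. *)
have [n0|n0] := eqVneq N 0.
  have M00 : M = 0 by rewrite /M /local_bound -NE n0 mul0r.
  have := davie_increment HW HWW alpha_gt M0 D0 w1 DY s0 (ltW st) th.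
  rewrite M00 (MD M00) mulr0 addr0 mul0r => /le_trans; apply.
  rewrite mulr_ge0// le_min n0 !(mulr0, mul0r) lexx andbT.
  by rewrite !mulr_ge0 ?powR_ge0// addr_ge0.
have kE : kap = Num.min 1 (Num.min (6 * gam)^-1 N) by rewrite /kap g0 n0.
have sh : s <= h by exact: le_trans (ltW st) th.
have ys : `|Y s| <= `|xi| + (6 * gam)^-1.
  have := davie_increment HW HWW alpha_gt M0 D0 w1 DY (lexx 0) s0 sh.
  rewrite DY.1 subr0 => inc.
  rewrite -(subrK xi (Y s)) (le_trans (ler_normD _ _))// addrC lerD2l.
  have sw : s `^ alpha <= h `^ alpha by rewrite powR_mono// ltW.
  apply: (le_trans inc); apply: (@le_trans _ _ kap).
    apply: le_trans Sh; rewrite ler_pM// ?powR_ge0//; last by rewrite /S; lra.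
    by rewrite addr_ge0// mulr_ge0.
  by rewrite kE !ge_min lexx orbT.
have eta : (M + D) * (t - s) `^ alpha <= kap.
  apply: le_trans Sh; rewrite ler_pM ?addr_ge0//; first by rewrite /S; lra.
  by rewrite powR_mono ?subr_ge0 ?(ltW al0) ?(ltW st)// (le_trans _ th)// gerBl.
have ex := davie_expansion HWW alpha_gt D0 w1 DY s0 (ltW st) th.
have fb := field_incr_bound T_gt0 rpW (Y s) (leq0n 3) s0 st (le_trans th hT).
rewrite -NE /= in fb.
have := ler_normD (Y t - Y s - field_incr W s t (Y s)) (field_incr W s t (Y s)).
rewrite subrK => /le_trans; apply; apply: (le_trans (lerD ex fb)).
set w := (t - s) `^ alpha in p0 eta *.
have -> : (M + D) * w ^+ 2 + N * w * (1 + `|Y s|) `^ beta 0%N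
  = (N * (1 + `|Y s|) `^ beta 0%N + (M + D) * w) * w by ring.
rewrite ler_wpM2r// le_min; apply/andP; split.
  apply: first_holder_bound => //.
  by rewrite (le_trans eta)// kE ge_min lexx.
apply: second_holder_bound => //.
by rewrite (le_trans eta)// kE !ge_min lexx !orbT.
Qed.
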